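(* Let $N\in\mathbb{N}$, let $\mathcal{M}\subset H^2\otimes\mathbb{C}^N$ be an invariant subspace of the $\mathbb{C}^N$-valued symmetric Fock space in two variables, and let $\mathcal{M}^\perp=(H^2\otimes\mathbb{C}^N)\ominus\mathcal{M}$. Equip $\mathcal{M}$ and $\mathcal{M}^\perp$ with their natural module structures over $\mathbb{C}[z,w]$, and let $I=(z,w)$. If $\dim\mathcal{M}/I\mathcal{M}<\infty$, then $$e(I,\mathcal{M})+e(I,\mathcal{M}^\perp)=N.$$
   Context: $H^2$ denotes the symmetric Fock space in two variables: the Hilbert space of holomorphic functions on the open unit ball $B_2\subset\mathbb{C}^2$ with reproducing kernel $\frac{1}{1-z\bar\zeta-w\bar\eta}$; $H^2\otimes\mathbb{C}^N$ is the space of $\mathbb{C}^N$-valued functions with entries in $H^2$. An invariant subspace is a closed subspace invariant under multiplication by the coordinate functions $z$ and $w$. The module structure on $\mathcal{M}$ is given by multiplication by $z,w$; on $\mathcal{M}^\perp$ it is given by the compressions to $\mathcal{M}^\perp$ of multiplication by $z,w$ (equivalently, $\mathcal{M}^\perp\cong (H^2\otimes\mathbb{C}^N)/\mathcal{M}$ as a quotient module). For such a module $H$ with $\dim H/IH<\infty$, the Samuel multiplicity is $e(I,H)=2!\lim_{k\to\infty}\frac{\dim H/I^kH}{k^2}$ (for $H=\mathcal{M}^\perp$ it is always well defined and finite). *)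

(* Defs.v *)
From HB Require Import structures.
From mathcomp Require Import all_boot all_order all_algebra.
From mathcomp Require Import complex.
From mathcomp Require Import all_classical all_reals all_analysis.

Set Implicit Arguments.
Unset Strict Implicit.
Unset Printing Implicit Defensive.

Import Order.TTheory GRing.Theory Num.Theory.
Import numFieldNormedType.Exports.

Local Open Scope classical_set_scope.
Local Open Scope ring_scope.

Section ReproducingKernel.
Context {R : realType} {X : Type}.
Local Notation C := R[i].

(* A Hilbert space of functions X -> C with reproducing kernel K.  The function
   [ip] is total, but only its values on [rk_space] are meaningful.  Such a
   space, with its inner product, is determined by K (Moore-Aronszajn). *)
Record rkhs (K : X -> X -> C) := Rkhs {
  rk_space : set (X -> C) ;
  ip : (X -> C) -> (X -> C) -> C ;
  rk_linear : forall (c : C) f g, rk_space f -> rk_space g ->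
    rk_space (fun x => c * f x + g x) ;
  ip_linear : forall (c : C) f g h,
    rk_space f -> rk_space g -> rk_space h ->
    ip (fun x => c * f x + g x) h = c * ip f h + ip g h ;
  ip_conj : forall f g, rk_space f -> rk_space g -> ip g f = (ip f g)^* ;
  ip_ge0 : forall f, rk_space f -> 0 <= ip f f ;
  ip_eq0 : forall f, rk_space f -> ip f f = 0 -> f = (fun=> 0) ;
  rk_complete : forall u : nat -> X -> C, (forall n, rk_space (u n)) ->
    (forall e : R, 0 < e -> exists n0 : nat, forall m n : nat,
       (n0 <= m)%N -> (n0 <= n)%N ->
       Num.sqrt (complex.Re (ip (u m - u n) (u m - u n))) < e) ->
    exists2 l, rk_space l &
      (fun n => Num.sqrt (complex.Re (ip (u n - l) (u n - l)))) @ \oo --> (0 : R) ;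
  rk_kernel : forall y, rk_space (fun x => K x y) ;
  rk_reproducing : forall f y, rk_space f -> f y = ip f (fun x => K x y)
}.

End ReproducingKernel.

Definition in_ball2 {R : realType} (p : R[i] * R[i]) : bool :=
  `|p.1| ^+ 2 + `|p.2| ^+ 2 < 1.

Definition ball2 (R : realType) := {p : R[i] * R[i] | in_ball2 p}.

(* [rkhs (@fock_kernel R)] is the symmetric Fock space H^2 on the ball.  Its
   elements are automatically holomorphic: the kernel is holomorphic in the
   first argument, and norm convergence implies locally uniform convergence. *)
Definition fock_kernel {R : realType} (p q : ball2 R) : R[i] :=
  (1 - (sval p).1 * ((sval q).1)^* - (sval p).2 * ((sval q).2)^*)^-1.

Section QuotientDimension.
Context {F : fieldType} {V : lmodType F}.

(* dim A/B = n, for subspaces B `<=` A of a possibly infinite-dimensional V: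
   the classes of the b i form a basis of A/B. *)
Definition is_quot_dim (A B : set V) (n : nat) : Prop :=
  exists2 b : 'I_n -> V, (forall i, A (b i)) &
    forall v, A v -> exists! c : 'rV[F]_n, B (v - \sum_i c 0 i *: b i).

Definition fin_quot_dim (A B : set V) : Prop := exists n, is_quot_dim A B n.

(* Value 0 when A/B is infinite-dimensional. *)
Definition quot_dim (A B : set V) : nat := xget 0%N (is_quot_dim A B).

End QuotientDimension.

Section SamuelMultiplicity.
Context (R : realType) {F : fieldType} {V : lmodType F}.

(* A module over C[z,w] is a subspace A with two commuting operators S, T on A,
   the actions of z and w.  For I = (z,w), the submodule I A is S A + T A, and
   I^k A is obtained by iterating A |-> I A. *)
Definition ideal_mul (S T : V -> V) (A : set V) : set V :=
  [set S f + T g | f in A & g in A].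

Definition ideal_pow_mul (S T : V -> V) (k : nat) (A : set V) : set V :=
  iter k (ideal_mul S T) A.

Definition samuel_seq (S T : V -> V) (A : set V) (k : nat) : R :=
  (2`!)%:R * ((quot_dim A (ideal_pow_mul S T k A))%:R / k%:R ^+ 2).

Definition samuel_defined (S T : V -> V) (A : set V) : Prop :=
  (forall k, fin_quot_dim A (ideal_pow_mul S T k A)) /\
  cvgn (samuel_seq S T A).

Definition samuel_mult (S T : V -> V) (A : set V) : R :=
  limn (samuel_seq S T A).

End SamuelMultiplicity.

Section VectorValuedFock.
Context {R : realType} (H2 : rkhs (@fock_kernel R)) {N : nat}.
Local Notation V := (ball2 R -> 'rV[R[i]]_N).

Definition coordf (f : V) (i : 'I_N) : ball2 R -> R[i] := fun x => f x 0 i.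

(* H^2 (x) C^N *)
Definition vfock : set V := [set f | forall i, rk_space H2 (coordf f i)].

Definition vip (f g : V) : R[i] := \sum_i ip H2 (coordf f i) (coordf g i).

Definition vnorm (f : V) : R := Num.sqrt (complex.Re (vip f f)).

Definition mulz (f : V) : V := fun x => (sval x).1 *: f x.
Definition mulw (f : V) : V := fun x => (sval x).2 *: f x.

Record invariant_subspace (M : set V) : Prop := InvariantSubspace {
  inv_sub : M `<=` vfock ;
  inv_0 : M 0 ;
  inv_linear : forall (c : R[i]) f g, M f -> M g -> M (c *: f + g) ;
  inv_closed : forall (u : nat -> V) (l : V), (forall n, M (u n)) -> vfock l ->
    (fun n => vnorm (u n - l)) @ \oo --> (0 : R) -> M l ;
  inv_mulz : forall f, M f -> M (mulz f) ;
  inv_mulw : forall f, M f -> M (mulw f)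
}.

Definition orth (M : set V) : set V :=
  [set f | vfock f /\ forall g, M g -> vip f g = 0].

(* Orthogonal projection onto a closed subspace K. *)
Definition proj (K : set V) (f : V) : V :=
  xget 0 [set g | K g /\ forall h, K h -> vip (f - g) h = 0].

Definition compress (K : set V) (T : V -> V) (f : V) : V := proj K (T f).

End VectorValuedFock.

(* Main.v *)
(* Let Z, W be the shifts restricted to M, with adjoints Z', W'. For y in M the vector
   g = (1 - ZZ' - WW') y satisfies p g in M for every p in H^2, and g = y modulo IM. So if
   M/IM is finite-dimensional, it is spanned by such multipliers f_1, ..., f_m. The minors
   of the matrix with rows f_1(x), ..., f_m(x) multiply H^2 into itself; let r be the
   maximal rank of this matrix and delta a nonzero r x r minor, of order d at the origin.
   Cramer's rule expresses every delta f_j through r of the generators, whence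
   dim M/I^k M <= r k^2/2 + O(k); conversely, with H the whole space, these r generators
   give dim M/(M cap I^k H) >= r (k - d)^2/2. Hence both dimensions are r k^2/2 + O(k) and
   e(I, M) = r. Since the orthocomplement Q of M is the module H/M, one has
   dim Q/I^k Q = dim H/I^k H - dim M/(M cap I^k H) = N k(k + 1)/2 - r k^2/2 + O(k), so
   e(I, Q) = N - r. *)
Require Import Defs.
From HB Require Import structures.
From mathcomp Require Import all_boot all_order all_algebra.
From mathcomp Require Import complex.
From mathcomp Require Import all_classical all_reals all_analysis.
From mathcomp Require Import zify ring lra.
Import Order.TTheory GRing.Theory Num.Theory.
Import numFieldNormedType.Exports.
Local Open Scope classical_set_scope.
Local Open Scope ring_scope.

Set Implicit Arguments.
Unset Strict Implicit.
Unset Printing Implicit Defensive.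

(** * Dimensions of quotients *)

Section QuotientDimensionTheory.
Context {F : fieldType} {V : lmodType F}.
Implicit Types (A B C : set V).

(** A product of two functions of H^2 may leave H^2, so minors of arbitrary generators of M would be
    useless; this forces the passage to multipliers. That g is one rests on the positivity of 1 -
    ZZ' - WW': for the Taylor polynomials p_n of p, invariance puts p_n g in M, and Cauchy-Schwarz
    for this form bounds its norm by |y| |p| for all n, so the limit p g is in M as well. Since H^2
    is known only through its kernel, its stability under z and w is likewise obtained from a bound
    on combinations of kernels. Power series are avoided: the adjoints of the shifts produce the
    Taylor polynomials, the order at the origin is a growth rate, and its additivity under products
    is read off on lines through the origin. No closure of I^k M is ever taken: a function of H^2 of
    order k + 1 is exactly z a + w b with a, b in H^2 of order k, so membership in I^k M can be
    checked by order of vanishing alone once a multiplier is factored out. *)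

Definition is_subspace A := A 0 /\ forall c f g, A f -> A g -> A (c *: f + g).

Lemma subspaceD A f g : is_subspace A -> A f -> A g -> A (f + g).
Proof. by case=> _ lA Af Ag; rewrite -[f]scale1r; apply: lA. Qed.

Lemma subspaceZ A c f : is_subspace A -> A f -> A (c *: f).
Proof. by case=> A0 lA Af; rewrite -[_ *: _]addr0; apply: lA. Qed.

Lemma subspaceN A f : is_subspace A -> A f -> A (- f).
Proof. by move=> sA Af; rewrite -scaleN1r; apply: subspaceZ. Qed.

Lemma subspaceB A f g : is_subspace A -> A f -> A g -> A (f - g).
Proof. by move=> sA Af Ag; apply: subspaceD => //; apply: subspaceN. Qed.

Lemma subspace_sum A (I : Type) (s : seq I) (P : pred I) (f : I -> V) :
  is_subspace A -> (forall i, P i -> A (f i)) -> A (\sum_(i <- s | P i) f i).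
Proof.
move=> sA Af; elim/big_ind: _ => //; first by case: sA.
by move=> x y; apply: subspaceD.
Qed.

Lemma subspace_sum_fin A (I : finType) (f : I -> V) :
  is_subspace A -> (forall i, A (f i)) -> A (\sum_i f i).
Proof. by move=> sA Af; apply: subspace_sum. Qed.

Lemma subspace_lincomb A (I : finType) (c : I -> F) (b : I -> V) :
  is_subspace A -> (forall i, A (b i)) -> A (\sum_i c i *: b i).
Proof. by move=> sA Ab; apply: subspace_sum => // i _; apply: subspaceZ. Qed.

Definition spans_mod A B (I : finType) (b : I -> V) :=
  forall v, A v -> exists c : I -> F, B (v - \sum_i c i *: b i).

Definition indep_mod B (I : finType) (b : I -> V) :=
  forall c : I -> F, B (\sum_i c i *: b i) -> forall i, c i = 0.

(** Uniqueness of the coordinates of the single vector 0 already gives independence; conversely, two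
    expansions of v differ by a combination in B. *)
Lemma is_quot_dimP A B n : A 0 -> is_subspace B ->
  is_quot_dim A B n <-> exists b : 'I_n -> V,
    [/\ forall i, A (b i), spans_mod A B b & indep_mod B b].
Proof.
move=> A0 sB; split.
  case=> b Ab bP; exists b; split => // [v /bP[c [cB _]]|c cB i].
    by exists (fun i => c 0 i).
  have [c0 [_ cu]] := bP 0 A0.
  have e1 : c0 = 0.
    apply: cu; rewrite big1 ?subr0; first by case: sB.
    by move=> k _; rewrite mxE scale0r.
  have e2 : c0 = \row_k c k.
    apply: cu; rewrite sub0r; apply: subspaceN => //.
    by under eq_bigr do rewrite mxE.
  by move: (e2); rewrite e1 => /rowP/(_ i); rewrite !mxE.
case=> b [Ab bs bi]; exists b => // v Av.
have [c cB] := bs v Av; exists (\row_k c k); split.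
  by under eq_bigr do rewrite mxE.
move=> d dB; apply/rowP => i; rewrite mxE; apply/eqP; rewrite -subr_eq0; apply/eqP.
apply: (bi (fun i => c i - d 0 i)).
have -> : \sum_i (c i - d 0 i) *: b i =
    (v - \sum_i d 0 i *: b i) - (v - \sum_i c i *: b i).
  rewrite opprB addrC addrA subrK -sumrB.
  by apply: eq_bigr => j _; rewrite scalerBl.
exact: subspaceB.
Qed.

Lemma sum_enum_val (I : finType) (c : I -> F) (b : I -> V) :
  \sum_(j < #|I|) c (enum_val j) *: b (enum_val j) = \sum_i c i *: b i.
Proof. exact: esym (big_enum_val (A := predT) (fun i => c i *: b i)). Qed.

(* More than #|I| vectors give a coefficient matrix with a nonzero row kernel. *)
Lemma leq_indep_span A B (I J : finType) (a : J -> V) (b : I -> V) :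
  is_subspace B -> spans_mod A B b -> (forall j, A (a j)) -> indep_mod B a ->
  (#|J| <= #|I|)%N.
Proof.
move=> sB bs Aa ai; rewrite leqNgt; apply/negP => ltIJ.
have [c cP] := choice (fun j => bs _ (Aa j)).
pose X : 'M[F]_(#|J|, #|I|) := \matrix_(j, i) c (enum_val j) (enum_val i).
have kX : kermx X != 0.
  rewrite -mxrank_eq0 mxrank_ker -lt0n subn_gt0.
  exact: leq_ltn_trans (rank_leq_col X) ltIJ.
have /rowV0Pn[u uX u0] := kX.
move/sub_kermxP: uX => uX.
have uai : indep_mod B (fun j : 'I_#|J| => a (enum_val j)).
  move=> d dB j; rewrite -[j]enum_valK.
  apply: (ai (fun k => d (enum_rank k))); rewrite -sum_enum_val.
  by under eq_bigr do rewrite enum_valK.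
case/eqP: u0; apply/rowP => j; rewrite mxE.
apply: (uai (fun j => u 0 j)).
have -> : \sum_j u 0 j *: a (enum_val j) =
    \sum_j u 0 j *: (a (enum_val j) - \sum_i c (enum_val j) i *: b i).
  under [RHS]eq_bigr do rewrite scalerBr scaler_sumr.
  rewrite sumrB exchange_big /= [X in _ - X]big1 ?subr0// => i _.
  under eq_bigr do rewrite scalerA.
  rewrite -scaler_suml.
  have /rowP/(_ (enum_rank i)) := uX; rewrite !mxE.
  under eq_bigr do rewrite mxE enum_rankK.
  by move=> ->; rewrite scale0r.
by apply: subspace_sum => // k _; apply: subspaceZ.
Qed.

Lemma is_quot_dim_fin A B (I : finType) (b : I -> V) : A 0 -> is_subspace B ->
  (forall i, A (b i)) -> spans_mod A B b -> indep_mod B b -> is_quot_dim A B #|I|.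
Proof.
move=> A0 sB Ab bs bi; apply/is_quot_dimP => //.
exists (fun j => b (enum_val j)); split => // [v /bs[c cB]|c cB j].
  by exists (fun j => c (enum_val j)); rewrite (sum_enum_val c).
rewrite -[j]enum_valK -[c _]/((fun i => c (enum_rank i)) (enum_val j)).
apply: bi; rewrite -sum_enum_val.
by under eq_bigr do rewrite enum_valK.
Qed.

Lemma leq_quot_dim_indep A B n (J : finType) (a : J -> V) : A 0 -> is_subspace B ->
  is_quot_dim A B n -> (forall j, A (a j)) -> indep_mod B a -> (#|J| <= n)%N.
Proof.
move=> A0 sB /(is_quot_dimP _ A0 sB)[b [Ab bs _]] Aa ai.
by rewrite -[n]card_ord; apply: leq_indep_span bs Aa ai.
Qed.

Lemma is_quot_dim_uniq A B n m : A 0 -> is_subspace B ->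
  is_quot_dim A B n -> is_quot_dim A B m -> n = m.
Proof.
move=> A0 sB dn dm; apply/eqP; rewrite eqn_leq.
have [[b [Ab _ bi]] [a [Aa _ ai]]] :=
  ((is_quot_dimP _ A0 sB).1 dn, (is_quot_dimP _ A0 sB).1 dm).
apply/andP; split.
  by rewrite -[n in (n <= _)%N]card_ord; apply: leq_quot_dim_indep dm Ab bi.
by rewrite -[m in (m <= _)%N]card_ord; apply: leq_quot_dim_indep dn Aa ai.
Qed.

Lemma quot_dimE A B n : A 0 -> is_subspace B -> is_quot_dim A B n ->
  quot_dim A B = n.
Proof.
move=> A0 sB dn; rewrite /quot_dim; case: xgetP => [m _ dm|/(_ n)//].
exact: is_quot_dim_uniq dm dn.
Qed.

Lemma spans_drop A B n (b : 'I_n.+1 -> V) : is_subspace B -> spans_mod A B b ->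
  (exists2 c : 'I_n.+1 -> F, B (\sum_i c i *: b i) & exists i, c i != 0) ->
  exists i0, spans_mod A B (fun j => b (lift i0 j)).
Proof.
move=> sB bs [c cB [i0 ci0]]; exists i0 => v /bs[d dB].
exists (fun j => d (lift i0 j) - d i0 / c i0 * c (lift i0 j)).
have -> : \sum_j (d (lift i0 j) - d i0 / c i0 * c (lift i0 j)) *: b (lift i0 j)
    = \sum_i d i *: b i - (d i0 / c i0) *: (\sum_i c i *: b i).
  rewrite [\sum_i d i *: _](bigD1_ord i0) //= [\sum_i c i *: _](bigD1_ord i0) //=.
  rewrite scalerDr scalerA divfK // scaler_sumr opprD addrACA subrr add0r -sumrB.
  by apply: eq_bigr => j _; rewrite scalerBl scalerA.
rewrite opprB addrA addrAC.
by apply: subspaceD => //; apply: subspaceZ.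
Qed.

Lemma span_quot_dim A B (I : finType) (b : I -> V) : A 0 -> is_subspace B ->
  (forall i, A (b i)) -> spans_mod A B b ->
  exists2 n, is_quot_dim A B n & (n <= #|I|)%N.
Proof.
move=> A0 sB Ab bs.
have {Ab bs} : exists b : 'I_#|I| -> V, (forall i, A (b i)) /\ spans_mod A B b.
  exists (fun j => b (enum_val j)); split => // v /bs[c cB].
  by exists (fun j => c (enum_val j)); rewrite (sum_enum_val c).
elim: #|I| => [|n IH] [{}b [Ab bs]].
  by exists 0%N => //; apply/is_quot_dimP => //; exists b; split => // c _ [].
have [dep|ndep] := EM (exists2 c : 'I_n.+1 -> F, B (\sum_i c i *: b i) &
    exists i, c i != 0).
  have [i0 i0s] := spans_drop sB bs dep.
  have [|m dm mn] := IH; first by exists (fun j => b (lift i0 j)); split.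
  by exists m => //; apply: leq_trans mn _.
exists n.+1 => //; apply/is_quot_dimP => //; exists b; split => // c cB i.
apply: contrapT => ci; apply: ndep; exists c => //; exists i; exact/eqP.
Qed.

Lemma quot_dimD A B C n m : is_subspace A -> is_subspace B -> is_subspace C ->
  C `<=` B -> B `<=` A ->
  is_quot_dim A B n -> is_quot_dim B C m -> is_quot_dim A C (n + m)%N.
Proof.
move=> sA sB sC CB BA.
have [[A0 _] [B0 _]] := (sA, sB).
move=> /(is_quot_dimP _ A0 sB)[a [Aa as_ ai]] /(is_quot_dimP _ B0 sC)[b [Bb bs bi]].
have -> : (n + m = #|{: 'I_n + 'I_m}|)%N by rewrite card_sum !card_ord.
apply: (@is_quot_dim_fin _ _ _ (fun k => match k with inl i => a i | inr j => b j end)) => //.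
- by case=> k //; apply: BA.
- move=> v /as_[c /bs[d dC]].
  exists (fun k => match k with inl i => c i | inr j => d j end).
  by rewrite big_sumType /= opprD addrA.
move=> c; rewrite big_sumType /= => cC.
have ca : forall i, c (inl i) = 0.
  apply: ai; rewrite -[X in B X](addrK (\sum_j c (inr j) *: b j)).
  by apply: subspaceB => //; [exact: CB|apply: subspace_lincomb].
move: cC; rewrite big1 ?add0r => [|i _]; last by rewrite ca scale0r.
by move=> /bi cb [].
Qed.

Lemma quot_dim_refl A : is_subspace A -> is_quot_dim A A 0.
Proof.
move=> sA; have [A0 _] := sA; apply/is_quot_dimP => //.
exists (fun=> 0); split => // [v Av|c _ []//].
by exists (fun=> 0); rewrite big_ord0 subr0.
Qed.

(** A spanning family of A/C spans A/B but need not lie in B, so the finiteness of B/C has to come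
    from a bound on independent families. *)
Lemma sub_quot_dim A B C n : is_subspace A -> is_subspace B -> is_subspace C ->
  C `<=` B -> B `<=` A -> is_quot_dim A C n ->
  exists m, [/\ (m <= n)%N, is_quot_dim A B m & is_quot_dim B C (n - m)].
Proof.
move=> sA sB sC CB BA; have [[A0 _] [B0 _]] := (sA, sB).
move=> dn; have := dn => /(is_quot_dimP _ A0 sC)[a [Aa as_ ai]].
have [|m dm mn] := @span_quot_dim A B _ a A0 sB Aa.
  by move=> v /as_[c /CB cB]; exists c.
rewrite card_ord in mn.
have [p dp] : exists p, is_quot_dim B C p.
  apply: contrapT => np.
  (* If B/C were infinite-dimensional, any independent family in B could be extended by one vector,
     past the bound n imposed by A/C. *)
  have grow k : exists b : 'I_k -> V, (forall i, B (b i)) /\ indep_mod C b.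
    elim: k => [|k [b [Bb bi]]]; first by exists (fun=> 0); split=> [[]//|c _ []].
    have [bs|nbs] := EM (spans_mod B C b).
      by case: np; exists k; apply/is_quot_dimP => //; exists b.
    have [v /not_implyP[Bv nv]] : exists v, ~ (B v -> exists c : 'I_k -> F,
        C (v - \sum_i c i *: b i)).
      by apply/existsNP => h; apply: nbs.
    exists (fun i => if unlift ord0 i is Some j then b j else v); split.
      by move=> i; case: unliftP.
    move=> c; rewrite big_ord_recl unlift_none.
    under eq_bigr do rewrite liftK.
    move=> cC.
    have c0 : c ord0 = 0.
      apply: contrapT => /eqP c0; apply: nv.
      exists (fun j => - (c ord0)^-1 * c (lift ord0 j)).
      have := subspaceZ (c ord0)^-1 sC cC.
      rewrite scalerDr scalerA mulVf // scale1r scaler_sumr -sumrN.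
      by under eq_bigr do rewrite scalerA -[_ *: _]opprK -scaleNr -mulNr.
    move: cC; rewrite c0 scale0r add0r => /bi cb i.
    by case: (unliftP ord0 i) => [j ->|->].
  have [b [Bb bi]] := grow n.+1.
  have : (#|'I_n.+1| <= n)%N.
    by apply: leq_quot_dim_indep dn _ bi => // i; apply: BA.
  by rewrite card_ord ltnn.
exists m; split => //.
have := quot_dimD sA sB sC CB BA dm dp => /(is_quot_dim_uniq A0 sC dn) ->.
by rewrite addKn.
Qed.

End QuotientDimensionTheory.

(** P induces an isomorphism from A/B to A'/B'. Linearity is asked only on A because P will be
    [proj], a choice function that is meaningful on the Fock space alone. *)
Lemma quot_dim_transport {F : fieldType} {V W : lmodType F} (A B : set V)
    (A' B' : set W) (P : V -> W) n :
  is_subspace A -> is_subspace B -> is_subspace A' -> is_subspace B' ->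
  (forall v, A v -> A' (P v)) ->
  (forall c f g, A f -> A g -> B' (P (c *: f + g) - (c *: P f + P g))) ->
  (forall v, A v -> B v <-> B' (P v)) ->
  (forall w, A' w -> exists2 v, A v & B' (w - P v)) ->
  is_quot_dim A B n -> is_quot_dim A' B' n.
Proof.
move=> sA sB sA' sB' PA Plin PB Psurj.
have [[A0 _] [A'0 _]] := (sA, sA').
move=> /(is_quot_dimP _ A0 sB)[b [Ab bs bi]].
apply/is_quot_dimP => //; exists (fun i => P (b i)).
have B'P f g : A f -> A g -> B (f - g) -> B' (P f - P g).
  rewrite addrC -scaleN1r => Af Ag Bfg.
  have h1 : B' (P (-1 *: g + f)) by apply/PB => //; case: sA => _; apply.
  have := subspaceB sB' h1 (Plin (-1) g f Ag Af).
  by rewrite opprB addrC subrK scaleN1r addrC.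
have sumP (c : 'I_n -> F) : B' (P (\sum_i c i *: b i) - \sum_i c i *: P (b i)).
  suff H : forall s : seq 'I_n,
      B' (P (\sum_(i <- s) c i *: b i) - \sum_(i <- s) c i *: P (b i)) by apply: H.
  elim=> [|i s IH].
    rewrite !big_nil subr0; apply/PB => //; by case: sB.
  rewrite !big_cons.
  have As : A (\sum_(j <- s) c j *: b j).
    by apply: subspace_sum => // j _; apply: subspaceZ.
  have := subspaceD sB' (Plin (c i) _ _ (Ab i) As) IH.
  by rewrite opprD !addrA subrK opprD addrA.
split => [i|w /Psurj[v Av B'v]|c cB'].
- exact: PA.
- have [c cB] := bs v Av; exists c.
  have Ac : A (\sum_i c i *: b i) by apply: subspace_lincomb.
  have := subspaceD sB' B'v (subspaceD sB' (B'P _ _ Av Ac cB) (sumP c)).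
  by rewrite [X in _ + X]addrA subrK addrA subrK.
apply: (bi c); apply/PB; first exact: subspace_lincomb.
by have := subspaceD sB' (sumP c) cB'; rewrite subrK.
Qed.

(** * Hilbert space toolbox *)

Section SquaredModulus.
Context {R : realType}.
Local Notation C := R[i].
Local Notation Re := complex.Re.
Local Notation Im := complex.Im.
Implicit Types x y z : C.

(** The norm on [R[i]] takes values in [R[i]]; estimates are made with this real squared modulus, a
    polynomial in the coordinates that suits [ring] and [lra]. *)
Definition sqm z : R := Re z ^+ 2 + Im z ^+ 2.

Lemma sqm_ge0 z : 0 <= sqm z.
Proof. by rewrite addr_ge0 ?sqr_ge0. Qed.

Lemma sqmE z : z * z^* = (sqm z)%:C%C.
Proof. by rewrite -normCK -add_Re2_Im2. Qed.

Lemma normsq_sqm z : `|z| ^+ 2 = (sqm z)%:C%C.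
Proof. by rewrite -add_Re2_Im2. Qed.

Lemma ReD x y : Re (x + y) = Re x + Re y.
Proof. by case: x y => a b [c d]. Qed.

Lemma ReN x : Re (- x) = - Re x.
Proof. by case: x. Qed.

Lemma ReB x y : Re (x - y) = Re x - Re y.
Proof. by rewrite ReD ReN. Qed.

Lemma ReJ x : Re x^* = Re x.
Proof. by case: x. Qed.

Lemma Re_real (t : R) x : Re (t%:C%C * x) = t * Re x.
Proof. by case: x => a b /=; rewrite mul0r subr0. Qed.

Lemma Re_sum (I : Type) (s : seq I) (P : pred I) (f : I -> C) :
  Re (\sum_(i <- s | P i) f i) = \sum_(i <- s | P i) Re (f i).
Proof. by elim/big_rec2: _ => // i a b _ <-; rewrite ReD. Qed.

Lemma Re_iM x : Re (- 'i%C * x) = Im x.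
Proof. by case: x => a b /=; ring. Qed.

Lemma sqmM x y : sqm (x * y) = sqm x * sqm y.
Proof. by case: x y => a b [c d]; rewrite /sqm /=; ring. Qed.

Lemma sqmJ x : sqm x^* = sqm x.
Proof. by case: x => a b; rewrite /sqm /= sqrrN. Qed.

Lemma sqmN x : sqm (- x) = sqm x.
Proof. by case: x => a b; rewrite /sqm /= !sqrrN. Qed.

Lemma sqm0 : sqm 0 = 0.
Proof. by rewrite /sqm /= expr0n addr0. Qed.

Lemma sqm1 : sqm 1 = 1.
Proof. by rewrite /sqm /= expr0n addr0 expr1n. Qed.

Lemma sqmR (t : R) : sqm t%:C%C = t ^+ 2.
Proof. by rewrite /sqm /= expr0n addr0. Qed.

Lemma sqmX x n : sqm (x ^+ n) = sqm x ^+ n.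
Proof. by elim: n => [|n IH]; rewrite ?sqm1// !exprS sqmM IH. Qed.

Lemma sqm_eq0 x : sqm x = 0 -> x = 0.
Proof.
case: x => a b /eqP; rewrite paddr_eq0 ?sqr_ge0// !sqrf_eq0 /=.
by case/andP => /eqP-> /eqP->.
Qed.

Lemma sqmD_le x y : sqm (x + y) <= 2 * sqm x + 2 * sqm y.
Proof.
case: x y => a b [c d]; rewrite /sqm /= -subr_ge0; set u := (X in 0 <= X).
have -> : u = (a - c) ^+ 2 + (b - d) ^+ 2 by rewrite /u; ring.
by rewrite addr_ge0 ?sqr_ge0.
Qed.

Lemma sqm_cauchy x y a b :
  sqm (x * a + y * b) <= (sqm x + sqm y) * (sqm a + sqm b).
Proof.
case: x y a b => x x' [y y'] [a a'] [b b']; rewrite /sqm /= -subr_ge0.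
set u := (X in 0 <= X).
(* Lagrange's identity: the defect in Cauchy-Schwarz is the squared modulus of x b^* - y a^*. *)
have -> : u = (x * b + x' * b' - y * a - y' * a') ^+ 2 +
    (x' * b - x * b' - y' * a + y * a') ^+ 2 by rewrite /u; ring.
by rewrite addr_ge0 ?sqr_ge0.
Qed.

Lemma sqm_Re x : Re x ^+ 2 <= sqm x.
Proof. by rewrite lerDl sqr_ge0. Qed.

End SquaredModulus.

Section HilbertSubsets.
Context {R : realType} {V : lmodType (R[i] : fieldType)}.
Local Notation C := R[i].
Local Notation Re := complex.Re.
Implicit Types (A B : set V) (ip : V -> V -> C).

Definition sqnorm ip (f : V) : R := Re (ip f f).

Definition sq_cvg ip (u : nat -> V) (l : V) :=
  forall e : R, 0 < e -> exists n0 : nat, forall n, (n0 <= n)%N ->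
    sqnorm ip (u n - l) < e.

(** The Hilbert structure lives on a subset of an ambient function space, so that the same lemmas
    serve H^2, its vector-valued version and M without subtypes. *)
Record hilbert A ip : Prop := Hilbert {
  hil_subspace : is_subspace A ;
  hil_linear : forall c f g h, A f -> A g -> A h ->
    ip (c *: f + g) h = c * ip f h + ip g h ;
  hil_conj : forall f g, A f -> A g -> ip g f = (ip f g)^* ;
  hil_ge0 : forall f, A f -> 0 <= ip f f ;
  hil_eq0 : forall f, A f -> ip f f = 0 -> f = 0 ;
  hil_complete : forall u : nat -> V, (forall n, A (u n)) ->
    (forall e : R, 0 < e -> exists n0 : nat, forall m n : nat,
       (n0 <= m)%N -> (n0 <= n)%N -> sqnorm ip (u m - u n) < e) ->
    exists2 l, A l & sq_cvg ip u l
}.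

Definition sq_closed ip A B := forall (u : nat -> V) l,
  (forall n, B (u n)) -> A l -> sq_cvg ip u l -> B l.

Context {A : set V} {ip : V -> V -> C} (hA : hilbert A ip).
Local Notation sA := (hil_subspace hA).
Local Notation sqn := (sqnorm ip).

Lemma ip0l h : A h -> ip 0 h = 0.
Proof.
move=> Ah; have [A0 _] := sA.
by have := hil_linear hA (-1) A0 A0 Ah; rewrite scaler0 addr0 mulN1r addNr.
Qed.

Lemma ipDl f g h : A f -> A g -> A h -> ip (f + g) h = ip f h + ip g h.
Proof.
by move=> Af Ag Ah; rewrite -[f]scale1r (hil_linear hA) // mul1r scale1r.
Qed.

Lemma ipZl c f h : A f -> A h -> ip (c *: f) h = c * ip f h.
Proof.
move=> Af Ah; have [A0 _] := sA.
by rewrite -[_ *: _]addr0 (hil_linear hA) // ip0l // addr0.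
Qed.

Lemma ipNl f h : A f -> A h -> ip (- f) h = - ip f h.
Proof. by move=> Af Ah; rewrite -scaleN1r ipZl // mulN1r. Qed.

Lemma ipBl f g h : A f -> A g -> A h -> ip (f - g) h = ip f h - ip g h.
Proof.
by move=> Af Ag Ah; rewrite ipDl ?ipNl //; apply: subspaceN => //; apply: sA.
Qed.

Lemma ipDr f g h : A f -> A g -> A h -> ip h (f + g) = ip h f + ip h g.
Proof.
move=> Af Ag Ah; have Afg : A (f + g) by apply: (subspaceD sA).
by rewrite (hil_conj hA Afg Ah) ipDl // rmorphD /= -(hil_conj hA Af Ah) -(hil_conj hA Ag Ah).
Qed.

Lemma ipZr c f h : A f -> A h -> ip h (c *: f) = c^* * ip h f.
Proof.
move=> Af Ah; have Acf : A (c *: f) by apply: (subspaceZ c sA).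
by rewrite (hil_conj hA Acf Ah) ipZl // rmorphM /= -(hil_conj hA Af Ah).
Qed.

Lemma ipNr f h : A f -> A h -> ip h (- f) = - ip h f.
Proof. by move=> Af Ah; rewrite -scaleN1r ipZr // rmorphN rmorph1 mulN1r. Qed.

Lemma ipBr f g h : A f -> A g -> A h -> ip h (f - g) = ip h f - ip h g.
Proof. by move=> Af Ag Ah; rewrite ipDr ?ipNr //; apply: (subspaceN sA). Qed.

Lemma ip_sumr (I : Type) (s : seq I) (c : I -> C) (f : I -> V) h :
  (forall i, A (f i)) -> A h ->
  ip h (\sum_(i <- s) c i *: f i) = \sum_(i <- s) (c i)^* * ip h (f i).
Proof.
move=> Af Ah; have [A0 _] := sA; elim: s => [|i s IH].
  by rewrite !big_nil (hil_conj hA) // ip0l // rmorph0.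
have Acf j : A (c j *: f j) by apply: (subspaceZ _ sA).
have As : A (\sum_(j <- s) c j *: f j).
  by apply: (@subspace_sum _ _ A I s xpredT (fun j => c j *: f j) sA) => j _.
by rewrite !big_cons ipDr // ipZr // IH.
Qed.

Lemma sqn_ge0 f : A f -> 0 <= sqn f.
Proof. by move=> Af; have := hil_ge0 hA Af; rewrite lecE => /andP[]. Qed.

Lemma sqnE f : A f -> ip f f = (sqn f)%:C%C.
Proof. by move=> Af; rewrite /sqnorm RRe_real // ger0_real // (hil_ge0 hA). Qed.

Lemma sqn_eq0 f : A f -> sqn f = 0 -> f = 0.
Proof. by move=> Af f0; apply: (hil_eq0 hA) => //; rewrite sqnE // f0. Qed.

Lemma sqnZ c f : A f -> sqn (c *: f) = sqm c * sqn f.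
Proof.
move=> Af; have Acf : A (c *: f) by apply: (subspaceZ c sA).
by rewrite /sqnorm ipZl // ipZr // mulrA sqmE Re_real.
Qed.

Lemma Re_ipC f g : A f -> A g -> Re (ip f g) = Re (ip g f).
Proof. by move=> Af Ag; rewrite (hil_conj hA Ag Af) ReJ. Qed.

Lemma sqnD f g : A f -> A g -> sqn (f + g) = sqn f + 2 * Re (ip f g) + sqn g.
Proof.
move=> Af Ag; have Afg := subspaceD sA Af Ag.
rewrite /sqnorm ipDl // !ipDr // !ReD (Re_ipC Ag Af); ring.
Qed.

Lemma sqnN f : A f -> sqn (- f) = sqn f.
Proof. by move=> Af; rewrite -scaleN1r sqnZ // sqmN sqm1 mul1r. Qed.

Lemma sqnB f g : A f -> A g -> sqn (f - g) = sqn f - 2 * Re (ip f g) + sqn g.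
Proof.
move=> Af Ag; have ANg := subspaceN sA Ag.
by rewrite sqnD // ipNr // ReN sqnN // mulrN.
Qed.

Lemma Re_ip_le f g : A f -> A g -> 2 * Re (ip f g) <= sqn f + sqn g.
Proof.
move=> Af Ag; rewrite -subr_ge0 [X in 0 <= X](_ : _ = sqn (f - g)).
  by rewrite sqn_ge0 //; apply: (subspaceB sA).
by rewrite sqnB //; ring.
Qed.

Lemma cauchy_schwarz f g : A f -> A g -> sqm (ip f g) <= sqn f * sqn g.
Proof.
move=> Af Ag; have := sqn_ge0 Ag; rewrite le0r => /orP[/eqP g0|g0].
  have -> : ip f g = 0 by rewrite (sqn_eq0 Ag g0) (hil_conj hA) ?ip0l ?conjC0 //; case: sA.
  by rewrite sqm0 g0 mulr0.
have Asf : A ((sqn g)%:C%C *: f) by apply: (subspaceZ _ sA).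
have Acg : A (ip f g *: g) by apply: (subspaceZ _ sA).
have := sqn_ge0 (subspaceB sA Asf Acg).
rewrite sqnB // !sqnZ // sqmR ipZl // ipZr // Re_real [_^* * _]mulrC sqmE /=.
by move=> h; rewrite -subr_ge0 -(pmulr_rge0 _ g0) (le_trans h) // le_eqVlt; apply/orP; left; apply/eqP; ring.
Qed.

(* Minimizes |J w|^2 - 2 Re (L w): the Riesz representation of a bounded
   functional given only on a subspace, parametrized by [J]. *)
Lemma riesz (W : Type) (w0 : W) (J : W -> V) (L : W -> C) (K : R) :
  (forall w, A (J w)) ->
  (forall c w1 w2, exists w, J w = c *: J w1 + J w2 /\ L w = c * L w1 + L w2) ->
  (forall w, 2 * Re (L w) <= sqn (J w) + K) ->
  exists f, [/\ A f, sqn f <= K, forall w, ip (J w) f = L w &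
    exists u, sq_cvg ip (J \o u) f].
Proof.
move=> AJ lin bnd.
pose Q w := sqn (J w) - 2 * Re (L w).
pose E := [set Q w | w in [set: W]].
have hE : has_inf E.
  split; first by exists (Q w0), w0.
  by exists (- K) => _ [w _ <-]; rewrite /Q; have := bnd w; lra.
pose m := inf E.
have mQ w : m <= Q w by apply: ge_inf; [case: hE|exists w].
have /choice[u uP] : forall n, exists w, Q w < m + n.+1%:R^-1.
  move=> n; have n0 : (0 : R) < n.+1%:R^-1 by rewrite invr_gt0 ltr0n.
  by have [_ [w _ <-] wm] := inf_adherent n0 hE; exists w.
have uP' (e : R) : 0 < e -> exists n0 : nat, forall n, (n0 <= n)%N -> Q (u n) < m + e.
  move=> e0; exists (Num.bound e^-1) => n n0n; apply: (lt_trans (uP n)).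
  rewrite ltrD2l invf_plt ?posrE // ?ltr0n //.
  apply: (lt_trans (archi_boundP _)); first by rewrite ltW // invr_gt0.
  by rewrite ltr_nat ltnS.
(* Parallelogram law at the midpoint of w1 and w2, where Q is at least m: minimizing sequences are
   Cauchy. *)
have cau w1 w2 : sqn (J w1 - J w2) <= 2 * (Q w1 - m) + 2 * (Q w2 - m).
  have [z0 [Jz0 Lz0]] := lin (-1) w1 w1.
  rewrite scaleN1r addNr in Jz0; rewrite mulN1r addNr in Lz0.
  have [z1 []] := lin 2^-1 w1 z0; rewrite Jz0 Lz0 !addr0 => Jz1 Lz1.
  have [z []] := lin 2^-1 w2 z1; rewrite Jz1 Lz1 -scalerDr -mulrDr => Jz Lz.
  have := mQ z; rewrite /Q Jz Lz.
  have A12 : A (J w2 + J w1) by apply: (subspaceD sA).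
  have c2 : (2^-1 : C) = (2^-1)%:C%C by rewrite fmorphV rmorph_nat.
  rewrite (sqnB (AJ w1) (AJ w2)) c2 sqnZ // Re_real ReD sqmR (sqnD (AJ w2) (AJ w1)) (Re_ipC (AJ w2)) //.
  have -> : (2^-1 : R) ^+ 2 = 4^-1 by rewrite exprVn -natrX.
  by lra.
have [|f Af uf] := @hil_complete _ _ hA (J \o u) (fun n => AJ (u n)).
  move=> e e0; have [n0 n0P] := uP' (e / 4) ltac:(lra).
  exists n0 => i j /n0P ni /n0P nj; apply: le_lt_trans (cau _ _) _; lra.
(* Compare m with Q at u_n + t w and let n grow. The factor 2 before t^2, instead of 1, pays for
   replacing J (u n) by its limit f in the inner product. *)
have main w (t : R) : 0 <= 2 * t * Re (ip (J w) f - L w) + 2 * t ^+ 2 * sqn (J w).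
  rewrite -[X in _ <= X]addr0; apply/ler_addgt0Pl => e e0; rewrite addr0.
  have [n0 n0P] := uP' (e / 2) ltac:(lra).
  have [n1 n1P] := uf (e / 2) ltac:(lra).
  have := n0P (maxn n0 n1) (leq_maxl _ _).
  have := n1P (maxn n0 n1) (leq_maxr _ _) => /=.
  set v := u (maxn n0 n1) => h1 h2.
  have [z [Jz Lz]] := lin t%:C%C w v.
  have := mQ z; rewrite /Q Jz Lz.
  have Atw : A (t%:C%C *: J w) by apply: (subspaceZ _ sA).
  have Ad : A (J v - f) by apply: (subspaceB sA).
  rewrite sqnD // ReD Re_real.
  have := Re_ip_le Atw Ad; rewrite ipBr // ReB.
  rewrite !ipZl // !Re_real sqnZ // sqmR ReB.
  move: h1 h2; rewrite /Q; lra.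
have Re0 w : Re (ip (J w) f - L w) = 0.
  set b := Re _; have [S0|S0] := eqVneq (sqn (J w)) 0.
    have := main w 1; have := main w (-1); rewrite S0 -/b; lra.
  have Sp : 0 < sqn (J w) by rewrite lt0r S0 sqn_ge0.
  have := main w (- b / (2 * sqn (J w))).
  rewrite -/b; set s := sqn _ in Sp *.
  have -> : 2 * (- b / (2 * s)) * b + 2 * (- b / (2 * s)) ^+ 2 * s = - (b ^+ 2 / (2 * s)).
    by field; rewrite lt0r_neq0.
  rewrite oppr_ge0 pmulr_lle0 ?invr_gt0 ?mulr_gt0 // => b0.
  by apply/eqP; rewrite -sqrf_eq0 eq_le b0 sqr_ge0.
have ipL w : ip (J w) f = L w.
  apply/eqP; rewrite -subr_eq0; apply/eqP.
  have [z0 [Jz0 Lz0]] := lin (-1) w w.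
  rewrite scaleN1r addNr in Jz0; rewrite mulN1r addNr in Lz0.
  (* Passing from w to -i w turns the real part of the error into its imaginary part. *)
  have [z []] := lin (- 'i%C) w z0; rewrite Jz0 Lz0 !addr0 => Jz Lz.
  have := Re0 z; rewrite Jz Lz ipZl // -mulrBr Re_iM.
  have := Re0 w; case: (_ - _) => a b /= -> ->; reflexivity.
exists f; split => //; last by exists u.
apply/ler_addgt0Pl => e /uf[n /(_ n (leqnn n)) /=].
have := bnd (u n); rewrite -ipL sqnB //; lra.
Qed.

Lemma ip_suml (I : Type) (s : seq I) (c : I -> C) (f : I -> V) h :
  (forall i, A (f i)) -> A h ->
  ip (\sum_(i <- s) c i *: f i) h = \sum_(i <- s) c i * ip (f i) h.
Proof.
move=> Af Ah.
have As : A (\sum_(j <- s) c j *: f j).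
  apply: (@subspace_sum _ _ A I s xpredT (fun j => c j *: f j) sA) => j _.
  exact: (subspaceZ _ sA).
rewrite (hil_conj hA Ah As) ip_sumr // rmorph_sum; apply: eq_bigr => i _.
by rewrite rmorphM /= conjCK -(hil_conj hA Ah).
Qed.

(** [riesz] on the span of the k t. Combinations are indexed by lists, since concatenation adds
    them. With k a reproducing kernel, this places a function in the space from an estimate
    alone. *)
Lemma interpolation (T : Type) (k : T -> V) (v : T -> C) (K : R) :
  (forall t, A (k t)) ->
  (forall s : seq (C * T), 2 * Re (\sum_(p <- s) p.1 * v p.2) <=
     sqn (\sum_(p <- s) p.1 *: k p.2) + K) ->
  exists f, [/\ A f, sqn f <= K & forall t, ip (k t) f = v t].
Proof.
move=> Ak bnd.
have [|||] := @riesz (seq (C * T)) [::] (fun s => \sum_(p <- s) p.1 *: k p.2)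
    (fun s => \sum_(p <- s) p.1 * v p.2) K.
- move=> s; apply: (@subspace_sum _ _ A _ s xpredT (fun p => p.1 *: k p.2) sA) => p _.
  exact: (subspaceZ _ sA).
- move=> c s1 s2; exists ([seq (c * p.1, p.2) | p <- s1] ++ s2).
  rewrite !big_cat !big_map /= scaler_sumr mulr_sumr; split; congr (_ + _);
  by apply: eq_bigr => p _; rewrite ?scalerA ?mulrA.
- exact: bnd.
move=> f [Af fK fP _]; exists f; split => // t.
by have := fP [:: (1, t)]; rewrite !big_seq1 scale1r mul1r.
Qed.

(** Represent h |-> <h, x> on B by [riesz]; its last conclusion makes f a limit of elements of B, so
    closedness puts f in B. *)
Lemma projection B x : is_subspace B -> B `<=` A -> sq_closed ip A B -> A x ->
  exists2 f, B f & forall h, B h -> ip (x - f) h = 0.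
Proof.
move=> sB BA cB Ax.
have [|||] := @riesz {b | B b} (exist _ 0 (proj1 sB)) (@proj1_sig _ _)
    (fun w => ip (sval w) x) (sqn x).
- by case=> b /= /BA.
- move=> c [b1 B1] [b2 B2] /=.
  exists (exist _ (c *: b1 + b2) (sB.2 c _ _ B1 B2)); split => //=.
  by rewrite (hil_linear hA) //; apply: BA.
- by case=> b /= /BA Ab; apply: Re_ip_le.
move=> f [Af _ fP [u uf]]; exists f.
  by apply: cB Af uf => n /=; case: (u n).
move=> h Bh; have Ah := BA _ Bh.
have Axf := subspaceB sA Ax Af.
by rewrite (hil_conj hA Ah Axf) ipBr // -(fP (exist _ h Bh)) subrr rmorph0.
Qed.

Lemma adjoint (S : V -> V) y : (forall h, A h -> A (S h)) ->
  (forall c f g, S (c *: f + g) = c *: S f + S g) ->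
  (forall h, A h -> sqn (S h) <= sqn h) -> A y ->
  exists2 x, A x & forall h, A h -> ip (S h) y = ip h x.
Proof.
move=> AS Slin Sle Ay.
have [|||] := @riesz {b | A b} (exist _ 0 (proj1 sA)) (@proj1_sig _ _)
    (fun w => ip (S (sval w)) y) (sqn y).
- by case.
- move=> c [b1 B1] [b2 B2] /=.
  exists (exist _ (c *: b1 + b2) (sA.2 c _ _ B1 B2)); split => //=.
  by rewrite Slin (hil_linear hA) //; apply: AS.
- case=> b /= Ab; apply: le_trans (Re_ip_le (AS _ Ab) Ay) _.
  by rewrite lerD2r Sle.
move=> x [Ax _ xP _]; exists x => // h Ah.
by rewrite (xP (exist _ h Ah)).
Qed.

(** * Row contractions and the defect form *)

Section RowContraction.
Variables Z W : V -> V.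
Hypothesis AZ : forall f, A f -> A (Z f).
Hypothesis AW : forall f, A f -> A (W f).
Hypothesis Zlin : forall c f g, Z (c *: f + g) = c *: Z f + Z g.
Hypothesis Wlin : forall c f g, W (c *: f + g) = c *: W f + W g.
Hypothesis rowc : forall f g, A f -> A g -> sqn (Z f + W g) <= sqn f + sqn g.

Definition adjoint_pair (h a b : V) := [/\ A h, A a, A b,
  forall f, A f -> ip (Z f) h = ip f a & forall f, A f -> ip (W f) h = ip f b].

Lemma adjoint_pair_ex h : A h -> exists a b, adjoint_pair h a b.
Proof.
move=> Ah; have [A0 _] := sA.
have Z0 : Z 0 = 0 by have := Zlin (-1) 0 0; rewrite scaler0 addr0 scaleN1r addNr.
have W0 : W 0 = 0 by have := Wlin (-1) 0 0; rewrite scaler0 addr0 scaleN1r addNr.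
have sq0 : sqn 0 = 0 by rewrite /sqnorm ip0l.
have Zle f : A f -> sqn (Z f) <= sqn f.
  by move=> Af; have := rowc Af A0; rewrite W0 sq0 !addr0.
have Wle f : A f -> sqn (W f) <= sqn f.
  by move=> Af; have := rowc A0 Af; rewrite Z0 sq0 !add0r.
have [a Aa aP] := adjoint AZ Zlin Zle Ah.
have [b Ab bP] := adjoint AW Wlin Wle Ah.
by exists a, b.
Qed.

(** Here a = Z'h and b = W'h. Expand |h - Za - Wb|^2 >= 0: the cross term is -2 (|a|^2 + |b|^2), and
    the row contraction bounds |Za + Wb|^2 by |a|^2 + |b|^2. *)
Lemma adjoint_pair_le h a b : adjoint_pair h a b -> sqn a + sqn b <= sqn h.
Proof.
case=> Ah Aa Ab aP bP.
have AZW : A (Z a + W b) by apply: (subspaceD sA); [apply: AZ|apply: AW].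
have := sqn_ge0 (subspaceB sA Ah AZW); rewrite sqnB // (Re_ipC Ah AZW).
rewrite ipDl //; try by [apply: AZ|apply: AW].
by rewrite aP // bP // ReD; have := rowc Aa Ab; rewrite /sqnorm; lra.
Qed.

Lemma adjoint_pairB c h a b y u v : adjoint_pair h a b -> adjoint_pair y u v ->
  adjoint_pair (h - c *: y) (a - c *: u) (b - c *: v).
Proof.
move=> [Ah Aa Ab aP bP] [Ay Au Av uP vP].
have Ac w : A w -> A (c *: w) by apply: (subspaceZ c sA).
split; try by [apply: (subspaceB sA Ah (Ac _ Ay))|apply: (subspaceB sA Aa (Ac _ Au))|
  apply: (subspaceB sA Ab (Ac _ Av))].
- move=> f Af; have Zf := AZ Af.
  by rewrite !ipBr ?ipZr ?aP ?uP //; apply: Ac.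
- move=> f Af; have Wf := AW Af.
  by rewrite !ipBr ?ipZr ?bP ?vP //; apply: Ac.
Qed.

(* Cauchy-Schwarz for the positive form <(1 - ZZ' - WW') y, h>, with primes for adjoints. *)
Lemma defect_le c h a b y u v : adjoint_pair h a b -> adjoint_pair y u v ->
  2 * Re (ip (c *: (y - Z u - W v)) h) <= sqm c * sqn y + sqn h - sqn a - sqn b.
Proof.
(* Nonnegativity of the form at h - c y; expanding yields the bound with an additional -|c|^2 (|u|^2
   + |v|^2), which is dropped. *)
move=> hab yuv; have := adjoint_pair_le (adjoint_pairB c hab yuv).
have [Ah Aa Ab aP bP] := hab; have [Ay Au Av uP vP] := yuv.
have Ac w : A w -> A (c *: w) by apply: (subspaceZ c sA).
have [Zu Wv] := (AZ Au, AW Av).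
have AyZ := subspaceB sA Ay Zu.
rewrite !sqnB ?sqnZ //; try by apply: Ac.
rewrite (Re_ipC Ah (Ac _ Ay)) (Re_ipC Aa (Ac _ Au)) (Re_ipC Ab (Ac _ Av)).
have AyZW := subspaceB sA AyZ Wv.
rewrite !ipZl // !ipBl // aP // bP // !mulrBr !ReB.
have := sqn_ge0 Au; have := sqn_ge0 Av; have := sqm_ge0 c; have := sqn_ge0 Ay.
nra.
Qed.

End RowContraction.

Lemma hilbert_sub B : is_subspace B -> B `<=` A -> sq_closed ip A B -> hilbert B ip.
Proof.
move=> sB BA cB; split => //.
- by move=> c f g h Bf Bg Bh; apply: (hil_linear hA); apply: BA.
- by move=> f g Bf Bg; apply: (hil_conj hA); apply: BA.
- by move=> f Bf; apply: (hil_ge0 hA); apply: BA.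
- by move=> f Bf; apply: (hil_eq0 hA); apply: BA.
move=> u Bu /(hil_complete hA (fun n => BA _ (Bu n)))[l Al ul].
by exists l => //; apply: cB Al ul.
Qed.

End HilbertSubsets.

(** * The symmetric Fock space *)

Section FockSpace.
Context {R : realType} (H2 : rkhs (@fock_kernel R)).
Local Notation C := R[i].
Local Notation X := (ball2 R).
Local Notation Re := complex.Re.
Local Notation HS := (rk_space H2).
Local Notation ip2 := (ip H2).
Local Notation sqn := (sqnorm ip2).

Definition cz (x : X) : C := (sval x).1.
Definition cw (x : X) : C := (sval x).2.
Definition rho (x : X) : R := sqm (cz x) + sqm (cw x).

Lemma rho_ge0 x : 0 <= rho x.
Proof. by rewrite addr_ge0 ?sqm_ge0. Qed.

Lemma in_ball2E (p : C * C) : in_ball2 p = (sqm p.1 + sqm p.2 < 1).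
Proof. by rewrite /in_ball2 !normsq_sqm -rmorphD /= -[1]/(1%:C)%C ltcR. Qed.

Lemma rho_lt1 x : rho x < 1.
Proof. by rewrite /rho /cz /cw; case: x => p /= h; rewrite -in_ball2E. Qed.

Lemma ball2_origin : in_ball2 (0 : C * C).
Proof. by rewrite in_ball2E /= sqm0 addr0. Qed.

Definition o2 : X := exist _ 0 ball2_origin.

Lemma fock_kernelE (x y : X) :
  fock_kernel x y = 1 + cz x * (cz y)^* * fock_kernel x y + cw x * (cw y)^* * fock_kernel x y.
Proof.
rewrite {1 3}/fock_kernel -/(cz x) -/(cz y) -/(cw x) -/(cw y).
rewrite /fock_kernel -/(cz x) -/(cz y) -/(cw x) -/(cw y).
set d := 1 - _ - _.
have d0 : d != 0.
  apply/eqP => d0.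
  have e : cz x * (cz y)^* + cw x * (cw y)^* = 1.
    by apply/eqP; rewrite eq_sym -subr_eq0 opprD addrA; apply/eqP.
  have := sqm_cauchy (cz x) (cw x) (cz y)^* (cw y)^*.
  rewrite e sqm1 !sqmJ leNgt => /negP; apply.
  by rewrite -/(rho x) -/(rho y) mulr_ilt1 ?rho_ge0 ?rho_lt1.
by move: d0; rewrite /d => d0; field.
Qed.

Definition ker (y : X) : X -> C := fun x => fock_kernel x y.

Lemma sqrt_ltP (x e : R) : 0 <= x -> 0 < e -> (Num.sqrt x < e) = (x < e ^+ 2).
Proof.
move=> x0 e0; rewrite -[e in LHS]gtr0_norm // -sqrtr_sqr ltr_sqrt //.
by rewrite exprn_gt0.
Qed.

Lemma hilbert_fock : hilbert (HS : set (X -> C)) ip2.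
Proof.
have sH : is_subspace (HS : set (X -> C)).
  split=> [|c f g Hf Hg]; last exact: rk_linear.
  have := rk_linear (-1) (rk_kernel H2 o2) (rk_kernel H2 o2).
  by congr (HS _); apply/funext => x /=; rewrite mulN1r addNr.
have ge0 f : HS f -> 0 <= Re (ip2 f f).
  by move=> /(ip_ge0)/=; rewrite lecE => /andP[].
split => //.
- by move=> c f g h Hf Hg Hh; apply: ip_linear.
- by move=> f g Hf Hg; apply: ip_conj.
- by move=> f Hf; apply: ip_ge0.
- by move=> f Hf; apply: ip_eq0.
move=> u Hu cau.
have [|l Hl ul] := @rk_complete _ _ _ H2 u Hu.
  move=> e e0; have [n0 n0P] := cau (e ^+ 2) (exprn_gt0 _ e0).
  exists n0 => m n hm hn; rewrite sqrt_ltP //; first exact: n0P.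
  by apply: ge0; apply: (subspaceB sH).
exists l => // e e0.
have se0 : 0 < Num.sqrt e by rewrite sqrtr_gt0.
move/cvgrPdist_lt : ul => /(_ _ se0)[n0 _ n0P].
exists n0 => n /n0P /=; rewrite sub0r normrN ger0_norm ?sqrtr_ge0 //.
by rewrite ltr_sqrt.
Qed.

Local Notation hH := hilbert_fock.
Local Notation sH := (hil_subspace hH).

Lemma ker_mem y : HS (ker y).
Proof. exact: rk_kernel. Qed.

Lemma reproducing f y : HS f -> ip2 f (ker y) = f y.
Proof. by move=> Hf; rewrite [f y](rk_reproducing y Hf). Qed.

Lemma reproducingC f y : HS f -> ip2 (ker y) f = (f y)^*.
Proof. by move=> Hf; rewrite (hil_conj hH Hf (ker_mem y)) reproducing. Qed.

(** The entrance to H^2 for functions not built from kernels by linear operations: a bound on the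
    functional that g defines on combinations of kernels. *)
Lemma fock_mem (g : X -> C) (K : R) :
  (forall s : seq (C * X), 2 * Re (\sum_(p <- s) p.1 * (g p.2)^*) <=
     sqn (\sum_(p <- s) p.1 *: ker p.2) + K) -> HS g /\ sqn g <= K.
Proof.
move=> bnd.
have [f [Hf fK fP]] := interpolation (v := fun y => (g y)^*) hH ker_mem bnd.
suff -> : g = f by [].
by apply/funext => y; have := fP y; rewrite reproducingC // => /(can_inj conjCK).
Qed.

(* The kernel identity (1 - <x, y>) K(x, y) = 1, summed against c. *)
Lemma sqn_kernel_comb (s : seq (C * X)) :
  sqn (\sum_(p <- s) p.1 *: ker p.2) = sqm (\sum_(p <- s) p.1)
   + sqn (\sum_(p <- s) (p.1 * (cz p.2)^*) *: ker p.2)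
   + sqn (\sum_(p <- s) (p.1 * (cw p.2)^*) *: ker p.2).
Proof.
have Hs (c : C * X -> C) : HS (\sum_(p <- s) c p *: ker p.2).
  apply: (@subspace_sum _ _ _ _ s xpredT (fun p => c p *: ker p.2) sH) => p _.
  by apply: (subspaceZ _ sH); apply: ker_mem.
have E (c : C * X -> C) : ip2 (\sum_(p <- s) c p *: ker p.2) (\sum_(p <- s) c p *: ker p.2)
    = \sum_(p <- s) \sum_(q <- s) c p * (c q)^* * fock_kernel q.2 p.2.
  rewrite (ip_suml hH) //; last by move=> p; apply: ker_mem.
  apply: eq_bigr => p _; rewrite (ip_sumr hH) ?mulr_sumr; try by move=> *; apply: ker_mem.
  by apply: eq_bigr => q _; rewrite reproducing ?mulrA //; apply: ker_mem.
have -> : sqm (\sum_(p <- s) p.1) = Re (\sum_(p <- s) \sum_(q <- s) p.1 * q.1^*).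
  rewrite -[LHS]/(Re (sqm (\sum_(p <- s) p.1))%:C%C) -sqmE rmorph_sum mulr_suml.
  by congr Re; apply: eq_bigr => p _; rewrite mulr_sumr.
rewrite /sqnorm !E -!ReD -!big_split /=; congr Re; apply: eq_bigr => p _.
rewrite -!big_split /=; apply: eq_bigr => q _.
rewrite {1}fock_kernelE !rmorphM /= !conjCK; ring.
Qed.

(** The adjoint of multiplication by z must send [ker y] to z(y)^* [ker y]; if this map contracts
    the combinations of kernels, multiplication by z is a contraction of H^2. *)
Lemma shift_mem (z : X -> C) f : HS f ->
  (forall s : seq (C * X), sqn (\sum_(p <- s) (p.1 * (z p.2)^*) *: ker p.2) <=
    sqn (\sum_(p <- s) p.1 *: ker p.2)) ->
  HS (fun x => z x * f x) /\ sqn (fun x => z x * f x) <= sqn f.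
Proof.
move=> Hf zc; apply: fock_mem => s.
have -> : \sum_(p <- s) p.1 * (z p.2 * f p.2)^* =
    ip2 (\sum_(p <- s) (p.1 * (z p.2)^*) *: ker p.2) f.
  rewrite (ip_suml hH) //; last by move=> p; apply: ker_mem.
  by apply: eq_bigr => p _; rewrite reproducingC // rmorphM mulrA.
apply: le_trans (Re_ip_le hH _ Hf) _; last by rewrite lerD2r.
apply: (@subspace_sum _ _ _ _ s xpredT (fun p => (p.1 * (z p.2)^*) *: ker p.2) sH) => p _.
by apply: (subspaceZ _ sH); apply: ker_mem.
Qed.

Lemma comb_ge0 (s : seq (C * X)) (c : C * X -> C) :
  0 <= sqn (\sum_(p <- s) c p *: ker p.2).
Proof.
apply: (sqn_ge0 hH).
apply: (@subspace_sum _ _ _ _ s xpredT (fun p => c p *: ker p.2) sH) => p _.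
by apply: (subspaceZ _ sH); apply: ker_mem.
Qed.

Lemma cz_mem f : HS f -> HS (fun x => cz x * f x) /\ sqn (fun x => cz x * f x) <= sqn f.
Proof.
move=> Hf; apply: shift_mem => // s; rewrite (sqn_kernel_comb s).
by rewrite addrAC lerDr addr_ge0 ?sqm_ge0 ?comb_ge0.
Qed.

Lemma cw_mem f : HS f -> HS (fun x => cw x * f x) /\ sqn (fun x => cw x * f x) <= sqn f.
Proof.
move=> Hf; apply: shift_mem => // s; rewrite (sqn_kernel_comb s).
by rewrite lerDr addr_ge0 ?sqm_ge0 ?comb_ge0.
Qed.

Lemma ker_o2 x : ker o2 x = 1.
Proof.
by rewrite /ker fock_kernelE /cz /cw /= conjC0 !mulr0 !mul0r !addr0.
Qed.

Lemma fock_cst (c : C) : HS (fun=> c).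
Proof.
have -> : (fun=> c) = c *: ker o2.
  by apply/funext => x; rewrite -[RHS]/(c * ker o2 x) ker_o2 mulr1.
by apply: (subspaceZ _ sH); apply: ker_mem.
Qed.

(** Gleason's problem at the origin, solved by a = Z'f and b = W'f. The kernel identity says that 1
    - ZZ' - WW' is the projection onto constants; pairing it with f gives the decomposition and the
    norm identity. *)
Lemma gleason f : HS f -> exists ab : (X -> C) * (X -> C),
  [/\ HS ab.1, HS ab.2,
      forall x, f x = f o2 + cz x * ab.1 x + cw x * ab.2 x,
      sqn f = sqm (f o2) + sqn ab.1 + sqn ab.2 &
      forall g h, HS g -> HS h ->
        ip2 (fun x => cz x * g x + cw x * h x) f = ip2 g ab.1 + ip2 h ab.2].
Proof.
move=> Hf.
have lin (z : X -> C) : forall c g h,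
    (fun x => z x * (c *: g + h) x) = c *: (fun x => z x * g x) + (fun x => z x * h x).
  by move=> c g h; apply/funext => x; rewrite /= mulrDr mulrCA.
have [a Ha aP] := adjoint hH (fun h Hh => (cz_mem Hh).1) (lin cz) (fun h Hh => (cz_mem Hh).2) Hf.
have [b Hb bP] := adjoint hH (fun h Hh => (cw_mem Hh).1) (lin cw) (fun h Hh => (cw_mem Hh).2) Hf.
have Hz h := @cz_mem h; have Hw h := @cw_mem h.
have adj g h : HS g -> HS h ->
    ip2 (fun x => cz x * g x + cw x * h x) f = ip2 g a + ip2 h b.
  move=> Hg Hh; rewrite -aP // -bP // -(ipDl hH) //.
  - exact: (Hz _ Hg).1.
  - exact: (Hw _ Hh).1.
have fE x : f x = f o2 + cz x * a x + cw x * b x.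
  have kx := ker_mem x.
  have [[zk _] [wk _]] := (Hz _ kx, Hw _ kx).
  rewrite -(reproducing x Ha) -(reproducing x Hb) (hil_conj hH kx Ha) (hil_conj hH kx Hb).
  rewrite -aP // -bP // -(hil_conj hH zk Hf) -(hil_conj hH wk Hf).
  rewrite -(reproducing o2 Hf) -[f x in LHS](reproducing x Hf).
  have e : ker x = ker o2 + (cz x)^* *: (fun y => cz y * ker x y) + (cw x)^* *: (fun y => cw y * ker x y).
    apply/funext => y.
    rewrite -[RHS]/(ker o2 y + (cz x)^* * (cz y * ker x y) + (cw x)^* * (cw y * ker x y)).
    by rewrite ker_o2 {1}/ker fock_kernelE /ker; ring.
  rewrite {1}e !(ipDr hH) ?(ipZr hH) ?conjCK //; try exact: ker_mem.
  - exact: (subspaceZ _ sH).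
  - by apply: (subspaceD sH); [exact: ker_mem|exact: (subspaceZ _ sH)].
  - exact: (subspaceZ _ sH).
exists (a, b); split => //=.
have Hab : HS (fun x => cz x * a x + cw x * b x).
  have := subspaceD sH (Hz _ Ha).1 (Hw _ Hb).1; exact.
have e : f = f o2 *: ker o2 + (fun x => cz x * a x + cw x * b x).
  by apply/funext => x; rewrite -[RHS]/(f o2 * ker o2 x + (cz x * a x + cw x * b x)) ker_o2 mulr1 addrA fE.
rewrite {1}/sqnorm {1}e (ipDl hH) ?(ipZl hH) ?adj ?reproducingC //; try exact: ker_mem.
  by rewrite sqmE !ReD addrA.
by apply: (subspaceZ _ sH); apply: ker_mem.
Qed.

(** For F = z g + w h with backward shifts a, b, one has |F|^2 = Re <g, a> + Re <h, b> and |a|^2 +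
    |b|^2 <= |F|^2, so the arithmetic-geometric inequality absorbs a and b. *)
Lemma row_contraction g h : HS g -> HS h ->
  sqn (fun x => cz x * g x + cw x * h x) <= sqn g + sqn h.
Proof.
move=> Hg Hh.
have HF : HS (fun x => cz x * g x + cw x * h x).
  have := subspaceD sH (cz_mem Hg).1 (cw_mem Hh).1; exact.
have [[a b] /= [Ha Hb _ nE adj]] := gleason HF.
have := Re_ip_le hH Hg Ha; have := Re_ip_le hH Hh Hb.
have : sqn (fun x => cz x * g x + cw x * h x) = Re (ip2 g a) + Re (ip2 h b).
  by rewrite -ReD -adj.
have := sqm_ge0 (cz o2 * g o2 + cw o2 * h o2).
move: nE; lra.
Qed.

Lemma eval_le f x : HS f -> sqm (f x) <= sqn f * Re (fock_kernel x x).
Proof.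
move=> Hf; rewrite -(reproducing x Hf).
have := cauchy_schwarz hH Hf (ker_mem x).
by rewrite {2}/sqnorm (reproducing _ (ker_mem x)).
Qed.

End FockSpace.

(** * Order of vanishing at the origin *)

Section VanishingOrder.
Context {R : realType} (H2 : rkhs (@fock_kernel R)).
Local Notation C := R[i].
Local Notation X := (ball2 R).
Local Notation Re := complex.Re.
Local Notation HS := (rk_space H2).
Local Notation ip2 := (ip H2).
Local Notation sqn := (sqnorm ip2).
Local Notation hH := (hilbert_fock H2).
Local Notation sH := (hil_subspace hH).
Implicit Types (f g u : X -> C).

(* f(x) = O(|x|^n) at the origin, stated with squared moduli: rho x = |x|^2. *)
Definition ord_ge n f := exists2 K : R, 0 <= K &
  forall x, rho x <= 2^-1 -> sqm (f x) <= K * rho x ^+ n.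

Lemma ord_geW m n f : (m <= n)%N -> ord_ge n f -> ord_ge m f.
Proof.
move=> mn [K K0 fK]; exists K => // x xh; apply: le_trans (fK x xh) _.
by rewrite ler_wpM2l // ler_wiXn2l ?rho_ge0 // ltW // rho_lt1.
Qed.

Lemma ord_geD n f g : ord_ge n f -> ord_ge n g -> ord_ge n (fun x => f x + g x).
Proof.
move=> [K K0 fK] [L L0 gL]; exists (2 * K + 2 * L); first by lra.
by move=> x xh; have := sqmD_le (f x) (g x); have := fK x xh; have := gL x xh; lra.
Qed.

Lemma ord_geM m n f g : ord_ge m f -> ord_ge n g -> ord_ge (m + n) (fun x => f x * g x).
Proof.
move=> [K K0 fK] [L L0 gL]; exists (K * L); first exact: mulr_ge0.
by move=> x xh; rewrite sqmM exprD mulrACA ler_pM ?sqm_ge0 ?fK ?gL.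
Qed.

Lemma ord_ge_cst c : ord_ge 0 (fun=> c).
Proof. by exists (sqm c); rewrite ?sqm_ge0 // => x _; rewrite expr0 mulr1. Qed.

Lemma ord_geZ n c f : ord_ge n f -> ord_ge n (fun x => c * f x).
Proof. exact: (ord_geM (ord_ge_cst c)). Qed.

Lemma ord_geN n f : ord_ge n f -> ord_ge n (fun x => - f x).
Proof. by move=> [K K0 fK]; exists K => // x xh; rewrite sqmN fK. Qed.

Lemma ord_geB n f g : ord_ge n f -> ord_ge n g -> ord_ge n (fun x => f x - g x).
Proof. by move=> fn /ord_geN; apply: ord_geD. Qed.

Lemma ord_ge0 n : ord_ge n (fun=> 0).
Proof. by exists 0 => // x _; rewrite sqm0 mul0r. Qed.

Lemma ord_ge_sum n (I : Type) (s : seq I) (F : I -> X -> C) :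
  (forall i, ord_ge n (F i)) -> ord_ge n (fun x => \sum_(i <- s) F i x).
Proof.
move=> Fn; elim: s => [|i s IH].
  by under eq_fun do rewrite big_nil; apply: ord_ge0.
by under eq_fun do rewrite big_cons; apply: ord_geD.
Qed.

Lemma ord_ge_cz : ord_ge 1 (@cz R).
Proof. by exists 1 => // x _; rewrite expr1 mul1r lerDl sqm_ge0. Qed.

Lemma ord_ge_cw : ord_ge 1 (@cw R).
Proof. by exists 1 => // x _; rewrite expr1 mul1r lerDr sqm_ge0. Qed.

Lemma ord_geX f n : ord_ge 1 f -> ord_ge n (fun x => f x ^+ n).
Proof.
move=> f1; elim: n => [|n IH].
  by under eq_fun do rewrite expr0; apply: ord_ge_cst.
by under eq_fun do rewrite exprS; apply: (@ord_geM 1 n).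
Qed.

Definition mon i j (x : X) : C := cz x ^+ i * cw x ^+ j.

Definition hom e (c : nat -> C) (x : X) : C := \sum_(j < e.+1) c j * mon (e - j) j x.

Lemma ord_ge_hom e c : ord_ge e (hom e c).
Proof.
apply: ord_ge_sum => j; apply: ord_geZ.
have := ord_geM (ord_geX (e - j) ord_ge_cz) (ord_geX j ord_ge_cw).
by rewrite subnK // -ltnS.
Qed.

(* The point (t, t s), for t small enough to be in the ball. *)
Definition pt (s : C) (t : R) : X := insubd (o2 : X) (t%:C%C, t%:C%C * s).

Lemma ptE s t : t ^+ 2 * (1 + sqm s) <= 2^-1 ->
  [/\ cz (pt s t) = t%:C%C, cw (pt s t) = t%:C%C * s & rho (pt s t) = t ^+ 2 * (1 + sqm s)].
Proof.
move=> h.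
have e : sval (pt s t) = (t%:C%C, t%:C%C * s).
  have hb : in_ball2 (t%:C%C, t%:C%C * s).
    rewrite in_ball2E /= sqmM sqmR; move: h; rewrite mulrDr mulr1; lra.
  exact: (@insubdK _ in_ball2 X).
by split; rewrite ?/rho /cz /cw e //= sqmM sqmR; ring.
Qed.

(** On the line, |u|^2 = t^(2n) |v|^2 is at most a constant times t^(2n+2); divide by t^(2n) and let
    t tend to 0. *)
Lemma ord_ge_line n u s v : ord_ge n.+1 u ->
  (forall t : R, 0 < t -> t ^+ 2 * (1 + sqm s) <= 2^-1 ->
     u (pt s t) = t%:C%C ^+ n * v) -> v = 0.
Proof.
move=> [K K0 uK] uv; apply: sqm_eq0; apply/eqP; rewrite eq_le sqm_ge0 andbT.
rewrite leNgt; apply/negP => v0.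
pose q := 1 + sqm s; have q1 : 1 <= q by rewrite lerDl sqm_ge0.
pose A := K * q ^+ n.+1 + 1.
have A1 : 1 <= A by rewrite lerDr mulr_ge0 // exprn_ge0 // (le_trans ler01 q1).
have q0 : 0 < q by lra.
have A0 : 0 < A by lra.
(* The first bound keeps the point in the region rho <= 1/2, the second makes t A < |v|^2. *)
pose t := Num.min (2 * q)^-1 (sqm v / (2 * A)).
have t0 : 0 < t by rewrite lt_min invr_gt0 divr_gt0 ?mulr_gt0.
have tq : t * q <= 2^-1.
  rewrite -ler_pdivlMr // -invfM; by rewrite ge_min lexx.
have tA : t * A < sqm v.
  rewrite -ltr_pdivlMr // (@le_lt_trans _ _ (sqm v / (2 * A))) //.
    by rewrite ge_min lexx orbT.
  rewrite ltr_pM2l // ltf_pV2 ?posrE ?mulr_gt0 //; lra.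
have t1 : t <= 1 by nra.
have tt : t ^+ 2 <= t by rewrite expr2 ler_piMl // ltW.
have th : t ^+ 2 * q <= 2^-1 by apply: le_trans tq; rewrite ler_pM2r.
have [_ _ rE] := ptE th.
have := uK (pt s t); rewrite uv // rE -/q => /(_ th).
rewrite sqmM sqmX sqmR => h.
have {}h : sqm v <= t ^+ 2 * (K * q ^+ n.+1).
  rewrite -(ler_pM2l (exprn_gt0 n (exprn_gt0 2 t0))).
  suff <- : K * (t ^+ 2 * q) ^+ n.+1 = (t ^+ 2) ^+ n * (t ^+ 2 * (K * q ^+ n.+1)) by [].
  by rewrite exprMn [(t ^+ 2) ^+ n.+1]exprS; ring.
have : t ^+ 2 * (K * q ^+ n.+1) <= t * A.
  apply: ler_pM => //; rewrite ?sqr_ge0 ?lerDl //.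
  by rewrite mulr_ge0 // exprn_ge0 // ltW.
lra.
Qed.

(** The dehomogenized form: on the line of slope s, [hom e c] is t^e times the value of this
    polynomial at s. *)
Definition homp e (c : nat -> C) : {poly C} := \poly_(j < e.+1) c j.

Lemma hom_pt e c s t : t ^+ 2 * (1 + sqm s) <= 2^-1 ->
  hom e c (pt s t) = t%:C%C ^+ e * (homp e c).[s].
Proof.
move=> /ptE[zE wE _]; rewrite horner_poly mulr_sumr; apply: eq_bigr => j _.
have -> : t%:C%C ^+ e = t%:C%C ^+ (e - j) * t%:C%C ^+ j.
  by rewrite -exprD subnK // -ltnS.
by rewrite /mon zE wE exprMn [RHS]mulrCA !mulrA.
Qed.

Lemma poly_eq0_horner (p : {poly C}) : (forall s, p.[s] = 0) -> p = 0.
Proof.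
move=> p0; apply/eqP/contraT => pn0.
have /(max_poly_roots pn0) : all (root p) [seq n%:R | n <- iota 0 (size p)].
  by apply/allP => x _; rewrite rootE p0.
rewrite size_map size_iota ltnn => -> //.
by rewrite map_inj_uniq ?iota_uniq // => m n /eqP; rewrite eqr_nat => /eqP.
Qed.

Lemma homp_eq0 e c : homp e c = 0 -> forall j, (j <= e)%N -> c j = 0.
Proof. by move=> /polyP h j je; have := h j; rewrite coef_poly ltnS je coef0. Qed.

Lemma hom_eq0 e c : homp e c = 0 -> hom e c = fun=> 0.
Proof.
move=> /homp_eq0 c0; apply/funext => x; rewrite /hom big1 // => j _.
by rewrite c0 ?mul0r // -ltnS.
Qed.

Lemma ord_ge_hom_eq0 e c : ord_ge e.+1 (hom e c) -> homp e c = 0.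
Proof.
move=> h; apply: poly_eq0_horner => s; apply: (ord_ge_line h) => t _ th.
exact: hom_pt.
Qed.

(** Uniqueness of Taylor polynomials. The top form is itself O(|x|^n), so removing it lets the
    induction kill the lower forms; then the top form stands alone. *)
Lemma ord_ge_sum_hom n (c : nat -> nat -> C) :
  ord_ge n (fun x => \sum_(e < n) hom e (c e) x) ->
  forall e, (e < n)%N -> homp e (c e) = 0.
Proof.
elim: n => // n IH h.
have {}IH : forall e, (e < n)%N -> homp e (c e) = 0.
  apply: IH.
  have := ord_geB (ord_geW (leqnSn n) h) (ord_ge_hom n (c n)).
  by under eq_fun do rewrite big_ord_recr /= addrK.
move=> e; rewrite ltnS leq_eqVlt => /orP[/eqP->|/IH//].
apply: ord_ge_hom_eq0.
suff -> : hom n (c n) = fun x => \sum_(e < n.+1) hom e (c e) x by [].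
apply/funext => x; rewrite big_ord_recr big1 /= ?add0r // => i _.
by rewrite hom_eq0 // IH.
Qed.

(** The last clause identifies the pair as (Z'f, W'f); it is fixed by choice so that [tay] can
    recurse on it. *)
Definition bshift f : (X -> C) * (X -> C) := xget (0, 0) [set ab |
  [/\ HS ab.1, HS ab.2,
      forall x, f x = f o2 + cz x * ab.1 x + cw x * ab.2 x,
      sqn f = sqm (f o2) + sqn ab.1 + sqn ab.2 &
      forall g h, HS g -> HS h ->
        ip2 (fun x => cz x * g x + cw x * h x) f = ip2 g ab.1 + ip2 h ab.2]].

Lemma bshiftP f : HS f ->
  [/\ HS (bshift f).1, HS (bshift f).2,
      forall x, f x = f o2 + cz x * (bshift f).1 x + cw x * (bshift f).2 x,
      sqn f = sqm (f o2) + sqn (bshift f).1 + sqn (bshift f).2 &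
      forall g h, HS g -> HS h ->
        ip2 (fun x => cz x * g x + cw x * h x) f = ip2 g (bshift f).1 + ip2 h (bshift f).2].
Proof. by move=> /gleason h; have := xgetPex (0, 0) h; exact. Qed.

(* The Taylor polynomial of degree < n, through f = f(0) + z (Z'f) + w (W'f), where the
   adjoints Z', W' of the shifts satisfy |Z'f|^2 + |W'f|^2 = |f|^2 - |f(0)|^2. *)
Fixpoint tay n f : X -> C :=
  if n is n'.+1 then
    fun x => f o2 + cz x * tay n' (bshift f).1 x + cw x * tay n' (bshift f).2 x
  else fun=> 0.

Lemma shift_memD (c : C) f g : HS f -> HS g ->
  HS (fun x => c + cz x * f x + cw x * g x).
Proof.
move=> Hf Hg.
have := subspaceD sH (subspaceD sH (fock_cst H2 c) (cz_mem Hf).1) (cw_mem Hg).1.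
exact.
Qed.

Lemma tay_mem n f : HS f -> HS (tay n f).
Proof.
elim: n f => [|n IH] f Hf; first exact: fock_cst.
by have [Ha Hb _ _ _] := bshiftP Hf; apply: shift_memD; apply: IH.
Qed.

Lemma fockB f g : HS f -> HS g -> HS (fun x => f x - g x).
Proof. by move=> Hf Hg; have := subspaceB sH Hf Hg; exact. Qed.

(** Each step gains a factor rho x by Cauchy-Schwarz, while the squared norms of the two backward
    shifts add up to at most that of f, so the constant does not grow with n. *)
Lemma tay_le n f x : HS f ->
  sqm (f x - tay n f x) <= rho x ^+ n * (sqn f * Re (fock_kernel x x)).
Proof.
elim: n f => [|n IH] f Hf; first by rewrite subr0 expr0 mul1r; apply: eval_le.
have [Ha Hb fE nE _] := bshiftP Hf => /=.
set a := (bshift f).1 in Ha fE nE *; set b := (bshift f).2 in Hb fE nE *.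
have -> : f x - (f o2 + cz x * tay n a x + cw x * tay n b x) =
    cz x * (a x - tay n a x) + cw x * (b x - tay n b x) by rewrite {1}fE; ring.
apply: le_trans (sqm_cauchy _ _ _ _) _.
rewrite -/(rho x) exprS -mulrA ler_wpM2l ?rho_ge0 //.
apply: le_trans (lerD (IH a Ha) (IH b Hb)) _.
rewrite -mulrDr -mulrDl ler_wpM2l ?exprn_ge0 ?rho_ge0 // ler_wpM2r //.
  have := sqn_ge0 hH (ker_mem H2 x).
  by rewrite /sqnorm (reproducing _ (ker_mem H2 x)).
by rewrite nE -addrA lerDr sqm_ge0.
Qed.

(** The kernel identity on the diagonal reads K = 1 + rho K; the radius in [ord_ge] keeps K
    bounded. *)
Lemma kernel_diag_le (x : X) : rho x <= 2^-1 -> Re (fock_kernel x x) <= 2.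
Proof.
move=> xh; have := fock_kernelE x x.
rewrite -addrA -mulrDl !sqmE -rmorphD /= -/(rho x) => /(congr1 (@complex.Re R)).
rewrite ReD Re_real /=; have := rho_ge0 x; nra.
Qed.

Lemma tay_ord n f : HS f -> ord_ge n (fun x => f x - tay n f x).
Proof.
move=> Hf; exists (sqn f * 2); first by rewrite mulr_ge0 // (sqn_ge0 hH).
move=> x xh; apply: le_trans (tay_le n x Hf) _.
rewrite mulrC ler_wpM2r ?exprn_ge0 ?rho_ge0 // ler_wpM2l ?(sqn_ge0 hH) //.
exact: kernel_diag_le.
Qed.

Lemma fock_bounded f : HS f -> ord_ge 0 f.
Proof. by move=> /(tay_ord 0); under eq_fun do rewrite /= subr0. Qed.

Lemma homS e (a b : nat -> C) x :
  hom e.+1 (fun j => (if (j <= e)%N then a j else 0) + (if j is j'.+1 then b j' else 0)) x =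
  cz x * hom e a x + cw x * hom e b x.
Proof.
rewrite /hom; under eq_bigr do rewrite mulrDl; rewrite big_split /=; congr (_ + _).
  rewrite big_ord_recr /= ltnn mul0r addr0 mulr_sumr; apply: eq_bigr => j _.
  by rewrite leq_ord subSn ?leq_ord // /mon exprS; ring.
rewrite big_ord_recl /= mul0r add0r mulr_sumr; apply: eq_bigr => j _.
by rewrite /bump leq0n add1n subSS /mon exprS; ring.
Qed.

Lemma tay_hom n f : exists c : nat -> nat -> C,
  forall x, tay n f x = \sum_(e < n) hom e (c e) x.
Proof.
elim: n f => [|n IH] f; first by exists (fun _ _ => 0) => x; rewrite big_ord0.
have [[a aE] [b bE]] := (IH (bshift f).1, IH (bshift f).2).
exists (fun e j => if e is e'.+1 then
  (if (j <= e')%N then a e' j else 0) + (if j is j'.+1 then b e' j' else 0) else f o2).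
move=> x; rewrite big_ord_recl /= {1}/hom big_ord1 /mon !expr0 !mulr1.
under eq_bigr do rewrite homS.
by rewrite big_split /= -!mulr_sumr -aE -bE addrA.
Qed.

Lemma tay_eq0 n f : HS f -> ord_ge n f -> tay n f = fun=> 0.
Proof.
move=> Hf fn; have [c cE] := tay_hom n f.
have := ord_geB fn (tay_ord n Hf); under eq_fun do rewrite opprB addrC subrK cE.
move=> /ord_ge_sum_hom c0; apply/funext => x; rewrite cE big1 // => e _.
by rewrite hom_eq0 // c0.
Qed.

Lemma leading_form n f : HS f -> ord_ge n f ->
  exists c, ord_ge n.+1 (fun x => f x - hom n c x).
Proof.
move=> Hf fn; have [c cE] := tay_hom n.+1 f; exists (c n).
have h : ord_ge n (fun x => \sum_(e < n) hom e (c e) x).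
  have := ord_geB (ord_geB fn (ord_geW (leqnSn n) (tay_ord n.+1 Hf))) (ord_ge_hom n (c n)).
  congr ord_ge; apply/funext => x; rewrite cE big_ord_recr /=; ring.
have -> : (fun x => f x - hom n (c n) x) = fun x => f x - tay n.+1 f x.
  apply/funext => x; rewrite cE big_ord_recr big1 /= ?add0r // => i _.
  by rewrite hom_eq0 // (ord_ge_sum_hom h).
exact: tay_ord.
Qed.

Lemma geometric_le0 (a r K : R) : 0 <= r < 1 -> (forall n, a <= r ^+ n * K) -> a <= 0.
Proof.
move=> /andP[r0 r1] aK.
have h : (fun n => r ^+ n * K) @ \oo --> 0 * K.
  by apply: cvgMr_tmp; apply: cvg_expr; rewrite ger0_norm.
rewrite mul0r in h.
have <- := cvg_lim (@Rhausdorff R) h.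
by apply: limr_ge; [apply/cvg_ex; exists 0|apply: nearW].
Qed.

(** [tay_le] holds on the whole ball with a ratio rho x < 1, so vanishing Taylor polynomials force f
    = 0 at every point at once. *)
Lemma identity_theorem f : HS f -> (forall n, ord_ge n f) -> f = fun=> 0.
Proof.
move=> Hf fo; apply/funext => x; apply: sqm_eq0; apply/eqP.
rewrite eq_le sqm_ge0 andbT.
apply: (@geometric_le0 _ (rho x) (sqn f * Re (fock_kernel x x))).
  by rewrite rho_ge0 rho_lt1.
by move=> n; have := tay_le n x Hf; rewrite tay_eq0 // subr0.
Qed.

(** The backward shifts minus their Taylor polynomials: the correction z (tay a) + w (tay b),
    together with f(0), is the Taylor polynomial of f, which vanishes. *)
Lemma ord_geS_div n f : HS f -> ord_ge n.+1 f -> exists a b,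
  [/\ HS a, HS b, ord_ge n a, ord_ge n b & forall x, f x = cz x * a x + cw x * b x].
Proof.
move=> Hf fn; have [Ha Hb fE _ _] := bshiftP Hf.
exists (fun x => (bshift f).1 x - tay n (bshift f).1 x).
exists (fun x => (bshift f).2 x - tay n (bshift f).2 x).
split; try by [apply: tay_ord|apply: fockB => //; apply: tay_mem].
move=> x; have /(congr1 (@^~ x)) /= := tay_eq0 Hf fn.
move=> h; rewrite -[LHS]subr0 -h {1}fE; ring.
Qed.

(* Leading homogeneous forms, restricted to the lines (t, t s), are polynomials in s;
   these form a domain. *)
Lemma vanishing_valuation f : HS f -> (exists x, f x != 0) ->
  exists d, forall p, HS p -> forall k, ord_ge (d + k) (fun x => f x * p x) -> ord_ge k p.
Proof.
move=> Hf [x0 fx0].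
have [d fd fd1] : exists2 d, ord_ge d f & ~ ord_ge d.+1 f.
  apply: contrapT => nd; case/eqP: fx0.
  suff fo : forall n, ord_ge n f by rewrite (identity_theorem Hf fo).
  elim=> [|n IH]; first exact: fock_bounded.
  by apply: contrapT => fn; apply: nd; exists n.
have [c cP] := leading_form Hf fd.
have c0 : homp d c != 0.
  apply/eqP => c0; apply: fd1; move: cP; rewrite hom_eq0 //.
  by under eq_fun do rewrite subr0.
exists d => p Hp; elim=> [_|k IH]; first exact: fock_bounded.
move=> fpk; have fpk' := fpk; rewrite addnS in fpk'.
have pk : ord_ge k p by apply: IH; apply: ord_geW fpk; rewrite leq_add2l.
have [b bP] := leading_form Hp pk.
(* With leading forms f_d and p_k, the product f_d p_k is f p - (f - f_d) p - f_d (p - p_k), and all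
   three terms have order d + k + 1. *)
have h : ord_ge (d + k).+1 (fun x => hom d c x * hom k b x).
  have h1 : ord_ge (d + k).+1 (fun x => (f x - hom d c x) * p x).
    by rewrite -addSn; apply: ord_geM.
  have h2 : ord_ge (d + k).+1 (fun x => hom d c x * (p x - hom k b x)).
    by rewrite -addnS; apply: ord_geM => //; apply: ord_ge_hom.
  have := ord_geB (ord_geB fpk' h1) h2; congr ord_ge.
  by apply/funext => x; ring.
have cb : homp d c * homp k b = 0.
  apply: poly_eq0_horner => s; rewrite hornerM; apply: (ord_ge_line h) => t _ th.
  by rewrite !hom_pt // exprD; ring.
move/eqP: cb; rewrite mulf_eq0 (negbTE c0) /= => /eqP b0.
by move: bP; rewrite hom_eq0 //; under eq_fun do rewrite subr0.
Qed.

Definition vanish k : set (X -> C) := [set f | HS f /\ ord_ge k f].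

Lemma vanish_subspace k : is_subspace (vanish k).
Proof.
split=> [|c f g [Hf fk] [Hg gk]].
  by split; [case: sH|apply: ord_ge0].
split; first by case: sH => _; apply.
exact: ord_geD (ord_geZ c fk) gk.
Qed.

Lemma hom_mem e c : HS (hom e c).
Proof.
elim: e c => [|e IH] c.
  have -> : hom 0 c = fun=> c 0%N.
    by apply/funext => x; rewrite /hom big_ord1 /mon !expr0 !mulr1.
  exact: fock_cst.
(* Every monomial divisible by z goes to the first part; only the pure power of w is left for the
   second. *)
have -> : hom e.+1 c = fun x => 0 + cz x * hom e c x + cw x * hom e (fun j => if j == e then c j.+1 else 0) x.
  apply/funext => x; rewrite add0r -homS /hom; apply: eq_bigr => j _; congr (_ * _).
  case: leqP => [je|ej]; last first.
    have -> : val j = e.+1 by apply/eqP; rewrite eqn_leq leq_ord.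
    by rewrite /= eqxx add0r.
  by case: (val j) je => [|i] ie; rewrite ?addr0 // ltn_eqF // addr0.
by apply: shift_memD; apply: IH.
Qed.

Lemma vanish0 : vanish 0 = HS.
Proof.
apply/seteqP; split=> [f []//|f Hf]; split=> //; exact: fock_bounded.
Qed.

(** Each quotient of successive terms is the space of forms of degree k, with its k + 1 monomials as
    basis. *)
Lemma quot_dim_vanish k : is_quot_dim (HS : set (X -> C)) (vanish k) 'C(k.+1, 2).
Proof.
elim: k => [|k IH]; first by rewrite vanish0; apply: (quot_dim_refl sH).
rewrite binS bin1.
have sub : vanish k.+1 `<=` vanish k.
  by move=> f [Hf fk]; split => //; apply: ord_geW fk.
apply: quot_dimD IH _ => //; try exact: vanish_subspace.
- exact: sH.
- by move=> f [].
rewrite -[X in is_quot_dim _ _ X]card_ord.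
have homE (c : 'I_k.+1 -> C) : \sum_i c i *: hom k (fun j => (j == i)%:R) =
    hom k (fun j => if insub j is Some i then c i else 0).
  apply/funext => x; rewrite fct_sumE; apply: eq_bigr => i _.
  rewrite valK -[LHS]/(c i * _) /hom; congr (_ * _).
  rewrite (bigD1 i) //= eqxx mul1r big1 ?addr0 // => j.
  by rewrite -val_eqE /= => /negbTE ->; rewrite mul0r.
apply: (@is_quot_dim_fin _ _ _ _ _ (fun i : 'I_k.+1 => hom k (fun j => (j == i)%:R))).
- by case: (vanish_subspace k).
- exact: vanish_subspace.
- by move=> i; split; [apply: hom_mem|apply: ord_ge_hom].
- move=> f [Hf fk]; have [c cP] := leading_form Hf fk.
  exists (fun i : 'I_k.+1 => c (val i)); rewrite homE; split.
    by apply: (subspaceB sH Hf); apply: hom_mem.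
  suff -> : hom k (fun j => if insub j is Some i then c (val (i : 'I_k.+1)) else 0) = hom k c by [].
  by apply/funext => x; apply: eq_bigr => i _; rewrite valK.
move=> c; rewrite homE => -[_ /ord_ge_hom_eq0 /homp_eq0 c0] i.
by have := c0 i (leq_ord i); rewrite valK.
Qed.

End VanishingOrder.

(** * Invariant subspaces and their multipliers *)

Section VectorFock.
Context {R : realType} (H2 : rkhs (@fock_kernel R)) {N : nat}.
Local Notation C := R[i].
Local Notation X := (ball2 R).
Local Notation Re := complex.Re.
Local Notation HS := (rk_space H2).
Local Notation ip2 := (ip H2).
Local Notation hH := (hilbert_fock H2).
Local Notation sH := (hil_subspace hH).
Local Notation V := (X -> 'rV[C]_N).
Local Notation VF := (vfock H2 : set V).
Local Notation vip := (@vip R H2 N).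
Local Notation vsq := (sqnorm vip).

Lemma coordfD (f g : V) i : coordf (f + g) i = coordf f i + coordf g i.
Proof. by apply/funext => x; rewrite /coordf mxE. Qed.

Lemma coordfB (f g : V) i : coordf (f - g) i = coordf f i - coordf g i.
Proof. by apply/funext => x; rewrite /coordf !mxE. Qed.

Lemma coordf_lin c (f g : V) i : coordf (c *: f + g) i = c *: coordf f i + coordf g i.
Proof. by apply/funext => x; rewrite /coordf !mxE. Qed.

Lemma coordf_inj (f g : V) : (forall i, coordf f i = coordf g i) -> f = g.
Proof.
move=> fg; apply/funext => x; apply/rowP => i.
by have := congr1 (@^~ x) (fg i).
Qed.

Lemma vfock_subspace : is_subspace VF.
Proof.
split=> [i|c f g Hf Hg i].
  have -> : coordf (0 : V) i = 0 by apply/funext => x; rewrite /coordf mxE.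
  by case: sH.
by rewrite coordf_lin; apply: sH.2.
Qed.

Lemma vsqE (f : V) : vsq f = \sum_i sqnorm ip2 (coordf f i).
Proof. by rewrite /sqnorm Re_sum. Qed.

Lemma vsq_coord (f : V) i : VF f -> sqnorm ip2 (coordf f i) <= vsq f.
Proof.
move=> Hf; rewrite vsqE (bigD1 i) //= lerDl sumr_ge0 // => j _.
exact: (sqn_ge0 hH).
Qed.

Lemma hilbert_vfock : hilbert VF vip.
Proof.
split.
- exact: vfock_subspace.
- move=> c f g h Hf Hg Hh; rewrite /Defs.vip mulr_sumr -big_split /=.
  by apply: eq_bigr => i _; rewrite coordf_lin (hil_linear hH).
- move=> f g Hf Hg; rewrite /Defs.vip rmorph_sum.
  by apply: eq_bigr => i _; apply: (hil_conj hH).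
- by move=> f Hf; apply: sumr_ge0 => i _; apply: (hil_ge0 hH).
- move=> f Hf f0; apply: coordf_inj => i.
  have -> : coordf (0 : V) i = 0 by apply/funext => x; rewrite /coordf mxE.
  apply: (hil_eq0 hH) => //; move/eqP: f0; rewrite psumr_eq0.
    by move=> /allP/(_ i (mem_index_enum i))/eqP.
  by move=> j _; apply: (hil_ge0 hH).
move=> u Hu cau.
have lim i : exists2 l, HS l & sq_cvg ip2 (fun n => coordf (u n) i) l.
  apply: (hil_complete hH) => [n|e /cau[n0 n0P]]; first exact: Hu.
  exists n0 => m n hm hn; apply: le_lt_trans (n0P m n hm hn).
  rewrite -coordfB; apply: vsq_coord; exact: (subspaceB vfock_subspace).
have /choice[l lP] : forall i, exists li, HS li /\ sq_cvg ip2 (fun n => coordf (u n) i) li.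
  by move=> i; have [li] := lim i; exists li.
pose L : V := fun x => \row_i l i x.
have LE i : coordf L i = l i by apply/funext => x; rewrite /coordf mxE.
exists L; first by move=> i; rewrite LE; case: (lP i).
move=> e e0.
(* N + 1 instead of N keeps the final inequality strict and covers N = 0. *)
have e1 : 0 < e / N.+1%:R by rewrite divr_gt0 // ltr0n.
have /choice[n0 n0P] : forall i, exists n0, forall n, (n0 <= n)%N ->
    sqnorm ip2 (coordf (u n) i - l i) < e / N.+1%:R.
  by move=> i; have [_ /(_ _ e1)] := lP i.
exists (\max_i n0 i) => n hn; rewrite vsqE.
have : \sum_i sqnorm ip2 (coordf (u n - L) i) <= \sum_(i < N) e / N.+1%:R.
  apply: ler_sum => i _; rewrite coordfB LE ltW // n0P //.
  exact: leq_trans (leq_bigmax i) hn.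
move/le_lt_trans; apply; rewrite sumr_const card_ord -[X in X < _]mulr_natr.
by rewrite -mulrA gtr_pMr // mulrC ltr_pdivrMr ?ltr0n // mul1r ltr_nat ltnSn.
Qed.

Local Notation hV := hilbert_vfock.

Lemma mulz_linear c (f g : V) : mulz (c *: f + g) = c *: mulz f + mulz g.
Proof.
apply/funext => x; rewrite -[RHS]/(c *: ((sval x).1 *: f x) + (sval x).1 *: g x).
by rewrite scalerA mulrC -scalerA -scalerDr.
Qed.

Lemma mulw_linear c (f g : V) : mulw (c *: f + g) = c *: mulw f + mulw g.
Proof.
apply/funext => x; rewrite -[RHS]/(c *: ((sval x).2 *: f x) + (sval x).2 *: g x).
by rewrite scalerA mulrC -scalerA -scalerDr.
Qed.

Lemma coordf_mulz (f : V) i : coordf (mulz f) i = fun x => cz x * coordf f i x.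
Proof. by apply/funext => x; rewrite /coordf mxE. Qed.

Lemma coordf_mulw (f : V) i : coordf (mulw f) i = fun x => cw x * coordf f i x.
Proof. by apply/funext => x; rewrite /coordf mxE. Qed.

Lemma vfock_mulz (f : V) : VF f -> VF (mulz f).
Proof. by move=> Hf i; rewrite coordf_mulz; apply: (cz_mem (Hf i)).1. Qed.

Lemma vfock_mulw (f : V) : VF f -> VF (mulw f).
Proof. by move=> Hf i; rewrite coordf_mulw; apply: (cw_mem (Hf i)).1. Qed.

Lemma vfock_row_contraction (f g : V) : VF f -> VF g ->
  vsq (mulz f + mulw g) <= vsq f + vsq g.
Proof.
move=> Hf Hg; rewrite !vsqE -big_split /=; apply: ler_sum => i _.
rewrite coordfD coordf_mulz coordf_mulw; exact: row_contraction.
Qed.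

Definition smul (p : X -> C) (g : V) : V := fun x => p x *: g x.

Lemma smulE p (g : V) x i : smul p g x 0 i = p x * g x 0 i.
Proof. by rewrite mxE. Qed.

Lemma coordf_smul p (g : V) i : coordf (smul p g) i = fun x => p x * coordf g i x.
Proof. by apply/funext => x; rewrite /coordf mxE. Qed.

Definition vker (x : X) (i : 'I_N) : V := fun y => ker x y *: delta_mx 0 i.

Lemma coordf_vker x i j : coordf (vker x i) j = (i == j)%:R *: ker x.
Proof.
apply/funext => y; rewrite /coordf !mxE eqxx /= mulrC.
by rewrite -[RHS]/(_ * ker x y) eq_sym.
Qed.

Lemma vker_mem x i : VF (vker x i).
Proof. by move=> j; rewrite coordf_vker; apply: (subspaceZ _ sH); apply: ker_mem. Qed.

Lemma vip_vker (f : V) x i : VF f -> vip f (vker x i) = f x 0 i.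
Proof.
move=> Hf; rewrite /Defs.vip (bigD1 i) //= big1 ?addr0.
  by rewrite coordf_vker eqxx scale1r (reproducing _ (Hf i)).
move=> j ji; rewrite coordf_vker eq_sym (negbTE ji) (ipZr hH) ?rmorph0 ?mul0r //.
exact: ker_mem.
Qed.

(** * The kernel of an invariant subspace and its multipliers *)

Section InvariantSubspace.
Variable M : set V.
Hypothesis invM : invariant_subspace H2 M.

Lemma inv_subspace : is_subspace M.
Proof. by split; [apply: inv_0 invM|move=> c f g; apply: (inv_linear invM)]. Qed.

Local Notation sM := inv_subspace.
Local Notation MV := (inv_sub invM).

Lemma inv_sq_closed : sq_closed vip VF M.
Proof.
move=> u l Mu Hl ul; apply: (inv_closed invM Mu Hl).
apply/cvgrPdist_lt => e e0; have [n0 n0P] := ul _ (exprn_gt0 2 e0).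
exists n0 => // n /n0P h /=; rewrite sub0r normrN ger0_norm ?sqrtr_ge0 //.
rewrite /vnorm sqrt_ltP //; apply: (sqn_ge0 hV); apply: (subspaceB vfock_subspace) => //.
exact: MV.
Qed.

Lemma hilbert_inv : hilbert M vip.
Proof. exact: (hilbert_sub hV inv_subspace MV inv_sq_closed). Qed.

Local Notation hM := hilbert_inv.

(** The reproducing kernel of M, obtained by projecting that of the whole space onto M. *)
Lemma inv_eval x i : exists2 k, M k & forall f, M f -> vip f k = f x 0 i.
Proof.
have [k Mk kP] := projection hV sM MV inv_sq_closed (vker_mem x i).
exists k => // f Mf; have Hf := MV Mf; have Hk := MV Mk.
rewrite -(vip_vker x i Hf); apply/eqP; rewrite eq_sym -subr_eq0.
have Hvk := subspaceB vfock_subspace (vker_mem x i) Hk.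
by rewrite -(ipBr hV (vker_mem x i) Hk Hf) (hil_conj hV Hvk Hf) kP // rmorph0.
Qed.

Lemma tay_cvg0 (p : X -> C) x c (e : R) : HS p -> 0 < e ->
  exists n0, forall n, (n0 <= n)%N -> Re (c * (p x - tay H2 n p x)^*) < e.
Proof.
move=> Hp e0.
pose K := sqm c * (sqnorm ip2 p * Re (fock_kernel x x)).
have : (fun n => rho x ^+ n * K) @ \oo --> 0 * K.
  by apply: cvgMr_tmp; apply: cvg_expr; rewrite ger0_norm ?rho_ge0 // rho_lt1.
rewrite mul0r => /cvgrPdist_lt/(_ _ (exprn_gt0 2 e0))[n0 _ n0P].
exists n0 => n /n0P /=; rewrite sub0r normrN => /(le_lt_trans (ler_norm _)) h.
rewrite ltNge; apply/negP => h2.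
have : e ^+ 2 <= Re (c * (p x - tay H2 n p x)^*) ^+ 2.
  by rewrite ler_sqr ?nnegrE ?(ltW e0) // (le_trans (ltW e0)).
apply/negP; rewrite -ltNge; apply: le_lt_trans (sqm_Re _) _.
rewrite sqmM sqmJ; apply: le_lt_trans h; rewrite /K mulrCA.
by rewrite ler_wpM2l ?sqm_ge0 // tay_le.
Qed.

Lemma tay_cvg0_sum (T : Type) (s : seq T) (p : X -> C) (c : T -> C) (x : T -> X) (e : R) :
  HS p -> 0 < e -> exists n0, forall n, (n0 <= n)%N ->
    Re (\sum_(t <- s) c t * (p (x t) - tay H2 n p (x t))^*) < e.
Proof.
move=> Hp; elim: s e => [|t s IH] e e0.
  by exists 0%N => n _; rewrite big_nil.
have e2 : 0 < e / 2 by lra.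
have [[n0 n0P] [n1 n1P]] := (tay_cvg0 (x t) (c t) Hp e2, IH _ e2).
exists (maxn n0 n1) => n; rewrite geq_max big_cons ReD => /andP[/n0P h0 /n1P h1].
lra.
Qed.

(** Bound p_n g for the Taylor polynomials p_n of p uniformly in n, then pass to the limit
    pointwise: [interpolation] with the kernel of M yields an element of M with the values of p
    g. *)
Lemma inv_multiplier y u v : adjoint_pair (A := M) (ip := vip) (@mulz R N) (@mulw R N) y u v ->
  forall p, HS p -> M (smul p (y - mulz u - mulw v)).
Proof.
move=> yuv; have [My Mu Mv _ _] := yuv.
have MZ := inv_mulz invM; have MW := inv_mulw invM.
have rowc f g : M f -> M g -> vsq (mulz f + mulw g) <= vsq f + vsq g.
  by move=> /MV Hf /MV Hg; apply: vfock_row_contraction.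
set g := y - mulz u - mulw v.
have Mg : M g by apply: (subspaceB sM (subspaceB sM My _)); [exact: MZ|exact: MW].
(* Write p_(n+1) g = p(0) g + Z(a_n g) + W(b_n g) and move the shifts onto h. The bounds for Z'h and
   W'h cancel the defect -|Z'h|^2 - |W'h|^2 in [defect_le], and |p|^2 = |p(0)|^2 + |a|^2 + |b|^2
   reassembles the constant. *)
have tayM n p : HS p -> M (smul (tay H2 n p) g) /\ forall h, M h ->
    2 * Re (vip (smul (tay H2 n p) g) h) <= vsq y * sqnorm ip2 p + vsq h.
  elim: n p => [|n IH] p Hp.
    have -> : smul (tay H2 0 p) g = 0.
      by apply/funext => x; rewrite /smul /= scale0r.
    split=> [|h Mh]; first exact: inv_0 invM.
    by rewrite (ip0l hM Mh) mulr0 addr_ge0 ?mulr_ge0 ?(sqn_ge0 hM) ?(sqn_ge0 hH).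
  have [Ha Hb _ nE _] := bshiftP Hp.
  have [[Ma aP] [Mb bP]] := (IH _ Ha, IH _ Hb).
  have -> : smul (tay H2 n.+1 p) g =
      p o2 *: g + mulz (smul (tay H2 n (bshift H2 p).1) g) + mulw (smul (tay H2 n (bshift H2 p).2) g).
    apply/funext => x; rewrite /smul /mulz /mulw /= !scalerDl.
    by rewrite -!scalerA.
  have [MZa MWb] := (MZ _ Ma, MW _ Mb).
  have Mcg : M (p o2 *: g) by apply: (subspaceZ _ sM).
  split=> [|h Mh]; first by apply: (subspaceD sM) => //; apply: (subspaceD sM).
  have [a [b hab]] := adjoint_pair_ex hM MZ MW mulz_linear mulw_linear rowc Mh.
  have [_ Ma' Mb' zP wP] := hab.
  have := defect_le hM MZ MW rowc (p o2) hab yuv; rewrite -/g.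
  have := aP _ Ma'; have := bP _ Mb'.
  rewrite (ipDl hM (subspaceD sM Mcg MZa) MWb Mh) (ipDl hM Mcg MZa Mh).
  rewrite zP // wP // !ReD nE; lra.
have /choice[k kP] : forall t : X * 'I_N, exists kt,
    M kt /\ forall f, M f -> vip f kt = f t.1 0 t.2.
  by move=> t; have [kt] := inv_eval t.1 t.2; exists kt.
move=> p Hp.
have [||f [Mf _ fP]] := @interpolation _ _ _ _ hM _ k
    (fun t => (p t.1 * g t.1 0 t.2)^*) (vsq y * sqnorm ip2 p).
- by move=> t; case: (kP t).
- move=> s; set J := \sum_(q <- s) _ *: _.
  have MJ : M J.
    apply: (@subspace_sum _ _ _ _ s xpredT (fun q => q.1 *: k q.2) sM) => q _.
    by apply: (subspaceZ _ sM); case: (kP q.2).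
  (* Half of e pays for replacing p by a Taylor polynomial at the finitely many points of s. *)
  apply/ler_addgt0Pl => e e0.
  have e2 : 0 < e / 2 by lra.
  have [n0 /(_ n0 (leqnn n0))] := tay_cvg0_sum s (fun q => q.1 * (g q.2.1 0 q.2.2)^*) (fun q => q.2.1) Hp e2.
  have [Mt /(_ _ MJ)] := tayM n0 p Hp.
  rewrite (Re_ipC hM Mt MJ) (ip_suml hM) //; last by move=> q; case: (kP q.2).
  have -> : \sum_(q <- s) q.1 * (p q.2.1 * g q.2.1 0 q.2.2)^* =
      \sum_(q <- s) q.1 * vip (k q.2) (smul (tay H2 n0 p) g) +
      \sum_(q <- s) q.1 * (g q.2.1 0 q.2.2)^* * (p q.2.1 - tay H2 n0 p q.2.1)^*.
    rewrite -big_split /=; apply: eq_bigr => q _.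
    have [Mk kE] := kP q.2.
    rewrite (hil_conj hM Mt Mk) kE // smulE -mulrA -mulrDr -rmorphM -rmorphD /=.
    by congr (_ * _^*); ring.
  rewrite ReD; lra.
suff -> : smul p g = f by [].
apply/funext => x; apply/rowP => i; rewrite smulE.
have [Mk kE] := kP (x, i); have := fP (x, i) => /=.
by rewrite (hil_conj hM Mf Mk) kE // => /(can_inj conjCK).
Qed.

Definition multipliers : set V := [set g | forall p, HS p -> M (smul p g)].

(* Modulo IM, y is congruent to the multiplier (1 - ZZ' - WW') y, with Z, W the
   shifts restricted to M and Z', W' their adjoints. *)
Lemma multiplier_mod y : M y -> exists g u v,
  [/\ multipliers g, M u, M v & y = g + (mulz u + mulw v)].
Proof.
move=> My; have MZ := inv_mulz invM; have MW := inv_mulw invM.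
have rowc f g : M f -> M g -> vsq (mulz f + mulw g) <= vsq f + vsq g.
  by move=> /MV Hf /MV Hg; apply: vfock_row_contraction.
have [u [v yuv]] := adjoint_pair_ex hM MZ MW mulz_linear mulw_linear rowc My.
have [_ Mu Mv _ _] := yuv.
exists (y - mulz u - mulw v), u, v; split => //; first exact: inv_multiplier yuv.
by rewrite [mulz u + _]addrC addrA subrK subrK.
Qed.

End InvariantSubspace.
End VectorFock.

(** * Lengths of M/I^k M *)

Lemma sum_pairE (U : nmodType) (I J : finType) (F : I * J -> U) :
  \sum_t F t = \sum_i \sum_j F (i, j).
Proof. by rewrite pair_bigA; apply: eq_bigr => -[]. Qed.

Section ModuleLengths.
Context {R : realType} (H2 : rkhs (@fock_kernel R)) {N : nat}.
Local Notation C := R[i].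
Local Notation X := (ball2 R).
Local Notation HS := (rk_space H2).
Local Notation hH := (hilbert_fock H2).
Local Notation sH := (hil_subspace hH).
Local Notation V := (X -> 'rV[C]_N).
Local Notation VF := (vfock H2 : set V).
Local Notation mz := (@mulz R N).
Local Notation mw := (@mulw R N).
Local Notation vip := (@vip R H2 N).
Local Notation sV := (@vfock_subspace R H2 N).

Lemma ideal_mul_subspace (A : set V) : is_subspace A -> is_subspace (ideal_mul mz mw A).
Proof.
move=> sA; have [A0 lA] := sA; split.
  exists 0 => //; exists 0 => //; apply/funext => x.
  by rewrite -[LHS]/(_ *: (0 : 'rV_N) + _ *: 0) !scaler0 addr0.
move=> c _ _ [f Af [g Ag <-]] [f' Af' [g' Ag' <-]].
exists (c *: f + f'); first exact: lA.
exists (c *: g + g'); first exact: lA.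
by rewrite mulz_linear mulw_linear scalerDr addrACA.
Qed.

Lemma ideal_pow_mul_subspace k (A : set V) : is_subspace A -> is_subspace (ideal_pow_mul mz mw k A).
Proof. by move=> sA; elim: k => // k IH; apply: ideal_mul_subspace. Qed.

(** This is I^k of the whole space by [vvanishS], in a form whose intersection with M can be tested
    coordinatewise. *)
Definition vvanish k : set V := [set f | forall i, vanish H2 k (coordf f i)].

Lemma vvanish_subspace k : is_subspace (vvanish k).
Proof.
split=> [i|c f g Hf Hg i].
  have -> : coordf (0 : V) i = 0 by apply/funext => x; rewrite /coordf mxE.
  by case: (vanish_subspace H2 k).
by rewrite coordf_lin; apply: (vanish_subspace H2 k).2.
Qed.

Lemma vvanish_sub k : vvanish k `<=` VF.
Proof. by move=> f fk i; case: (fk i). Qed.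

Lemma vvanishS k : vvanish k.+1 = ideal_mul mz mw (vvanish k).
Proof.
apply/seteqP; split=> [f fk|_ [f fk [g gk <-]] i]; last first.
  rewrite coordfD coordf_mulz coordf_mulw.
  have [[Hf fo] [Hg go]] := (fk i, gk i).
  split; first exact: (subspaceD sH (cz_mem Hf).1 (cw_mem Hg).1).
  by apply: ord_geD; [apply: (ord_geM (ord_ge_cz (R := R)))|apply: (ord_geM (ord_ge_cw (R := R)))].
have /choice[ab abP] : forall i, exists ab : (X -> C) * (X -> C),
    [/\ vanish H2 k ab.1, vanish H2 k ab.2 &
      forall x, coordf f i x = cz x * ab.1 x + cw x * ab.2 x].
  by move=> i; have [Hf /(ord_geS_div Hf)[a [b []]]] := fk i; exists (a, b).
have cE (h : 'I_N -> X -> C) i : coordf (fun x => \row_j h j x : 'rV_N) i = h i.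
  by apply/funext => x; rewrite /coordf mxE.
exists (fun x => \row_j (ab j).1 x); first by move=> i; rewrite cE; case: (abP i).
exists (fun x => \row_j (ab j).2 x); first by move=> i; rewrite cE; case: (abP i).
apply: coordf_inj => i; rewrite coordfD coordf_mulz coordf_mulw !cE.
by apply/funext => x; have [_ _ ->] := abP i.
Qed.

Lemma coordf_lincomb (I : finType) (c : I -> C) (b : I -> V) j :
  coordf (\sum_i c i *: b i) j = \sum_i c i *: coordf (b i) j.
Proof.
apply/funext => x; rewrite /coordf !fct_sumE summxE; apply: eq_bigr => i _.
by rewrite -[LHS]/((c i *: b i x) 0 j) mxE.
Qed.

Lemma quot_dim_vvanish k : is_quot_dim VF (vvanish k) (N * 'C(k.+1, 2)).
Proof.
have sv := vanish_subspace H2 k.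
have [e [He es ei]] := (is_quot_dimP _ sH.1 sv).1 (quot_dim_vanish H2 k).
set D := 'C(k.+1, 2) in e He es ei *.
have -> : (N * D = #|{: 'I_N * 'I_D}|)%N by rewrite card_prod !card_ord.
pose b (t : 'I_N * 'I_D) : V := smul (e t.2) (fun=> delta_mx 0 t.1).
have bE (c : 'I_N * 'I_D -> C) j : coordf (\sum_t c t *: b t) j = \sum_l c (j, l) *: e l.
  rewrite coordf_lincomb sum_pairE /=.
  rewrite (bigD1 j) //= [X in _ + X]big1 ?addr0.
    apply: eq_bigr => l _; congr (_ *: _); apply/funext => x.
    by rewrite coordf_smul /coordf mxE !eqxx mulr1.
  move=> i ij; apply: big1 => l _; apply/funext => x.
  rewrite -[LHS]/(c (i, l) * coordf (b (i, l)) j x) coordf_smul /coordf mxE eqxx /=.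
  by rewrite eq_sym (negbTE ij) !mulr0.
apply: (@is_quot_dim_fin _ _ _ _ _ b).
- exact: sV.1.
- exact: vvanish_subspace.
- move=> t i; rewrite coordf_smul.
  have := subspaceZ ((delta_mx 0 t.1 : 'rV[C]_N) 0 i) sH (He t.2); congr (HS _).
  by apply/funext => x; rewrite -[LHS]/(_ * e t.2 x) mulrC.
- move=> f Hf; have /choice[c cP] := fun j => es _ (Hf j).
  by exists (fun t => c t.1 t.2) => j; rewrite coordfB bE; apply: cP.
move=> c cv [j l]; apply: (ei (fun l => c (j, l))).
by rewrite -bE; apply: cv.
Qed.

(** The multiplier algebra of H^2. Being closed under products, it contains the minors and cofactors
    of matrices with entries in it. *)
Definition scalar_multipliers : set (X -> C) :=
  [set q | forall p, HS p -> HS (fun x => q x * p x)].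
Local Notation SM := scalar_multipliers.

Lemma scalar_multiplier_mem q : SM q -> HS q.
Proof.
move=> /(_ _ (fock_cst H2 1)); congr (HS _).
by apply/funext => x; rewrite mulr1.
Qed.

Lemma scalar_multiplierD q q' : SM q -> SM q' -> SM (fun x => q x + q' x).
Proof.
move=> Sq Sq' p Hp; have := subspaceD sH (Sq p Hp) (Sq' p Hp); congr (HS _).
by apply/funext => x; rewrite mulrDl.
Qed.

Lemma scalar_multiplierM q q' : SM q -> SM q' -> SM (fun x => q x * q' x).
Proof.
move=> Sq Sq' p Hp; have := Sq _ (Sq' p Hp); congr (HS _).
by apply/funext => x; rewrite mulrA.
Qed.

Lemma scalar_multiplier_cst c : SM (fun=> c).
Proof. by move=> p Hp; have := subspaceZ c sH Hp; exact. Qed.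

Lemma scalar_multiplier_sum (I : Type) (s : seq I) (P : pred I) (F : I -> X -> C) :
  (forall i, SM (F i)) -> SM (fun x => \sum_(i <- s | P i) F i x).
Proof.
move=> SF; elim: s => [|i s IH].
  by under eq_fun do rewrite big_nil; apply: scalar_multiplier_cst.
under eq_fun do rewrite big_cons.
by case: (P i) => //; apply: scalar_multiplierD.
Qed.

Lemma scalar_multiplier_prod (I : Type) (s : seq I) (P : pred I) (F : I -> X -> C) :
  (forall i, SM (F i)) -> SM (fun x => \prod_(i <- s | P i) F i x).
Proof.
move=> SF; elim: s => [|i s IH].
  by under eq_fun do rewrite big_nil; apply: scalar_multiplier_cst.
under eq_fun do rewrite big_cons.
by case: (P i) => //; apply: scalar_multiplierM.
Qed.

Lemma scalar_multiplier_det n (A : X -> 'M[C]_n) :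
  (forall i j, SM (fun x => A x i j)) -> SM (fun x => \det (A x)).
Proof.
move=> SA; apply: scalar_multiplier_sum => s.
apply: scalar_multiplierM; first exact: scalar_multiplier_cst.
by apply: scalar_multiplier_prod.
Qed.

Lemma scalar_multiplier_adj n (A : X -> 'M[C]_n) i j :
  (forall i j, SM (fun x => A x i j)) -> SM (fun x => \adj (A x) i j).
Proof.
move=> SA; under eq_fun do rewrite mxE /cofactor.
apply: scalar_multiplierM; first exact: scalar_multiplier_cst.
apply: scalar_multiplier_det => i' j'.
by under eq_fun do rewrite !mxE; apply: SA.
Qed.

Section InvariantSubspace.
Variable M : set V.
Hypothesis invM : invariant_subspace H2 M.
Local Notation sM := (inv_subspace invM).
Local Notation MV := (inv_sub invM).
Local Notation IM := (fun k => ideal_pow_mul mz mw k M).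
Local Notation mult := (multipliers H2 M).

Lemma ideal_pow_mul_sub k : IM k `<=` M.
Proof.
elim: k => // k IH _ [f /IH Mf [g /IH Mg <-]].
by apply: (subspaceD sM); [apply: (inv_mulz invM)|apply: (inv_mulw invM)].
Qed.

Lemma ideal_pow_mul_vvanish k : IM k `<=` vvanish k.
Proof.
elim: k => [f Mf i|k IH _ [f /IH Mf [g /IH Mg <-]]].
  by rewrite vanish0; apply: MV.
by rewrite vvanishS; exists f => //; exists g.
Qed.

Lemma multiplier_coord g i : mult g -> SM (coordf g i).
Proof.
move=> Mg p Hp; have := MV (Mg p Hp) i; rewrite coordf_smul; congr (HS _).
by apply/funext => x; rewrite mulrC.
Qed.

(** Divide p by z and w inside H^2, k times; the quotients times the multiplier g remain in M. *)
Lemma smul_vanish k p g : mult g -> vanish H2 k p -> IM k (smul p g).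
Proof.
move=> Mg; elim: k p => [|k IH] p [Hp pk]; first exact: Mg.
have [a [b [Ha Hb ao bo abE]]] := ord_geS_div Hp pk.
exists (smul a g); first by apply: IH.
exists (smul b g); first by apply: IH.
apply/funext => x; rewrite -[LHS]/(cz x *: (a x *: g x) + cw x *: (b x *: g x)).
by rewrite !scalerA -scalerDl -abE.
Qed.

(** * Length bounds from r generators and a minor *)

Section Generators.
Context {m : nat} (f : 'I_m -> V).
Hypothesis f_mult : forall i, mult (f i).
Hypothesis f_gen : spans_mod M (ideal_mul mz mw M) f.

(** Substitute M = span(f) + IM into itself k times; the coefficients collected along the way are
    polynomials in z and w. *)
Lemma generators_pow k y : M y -> exists p : 'I_m -> X -> C,
  (forall i, HS (p i)) /\ IM k (y - \sum_i smul (p i) (f i)).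
Proof.
elim: k y => [|k IH] y My.
  exists (fun _ => 0); split; first by move=> i; case: sH.
  have f0 i : M (smul 0 (f i)) by apply: f_mult; case: sH.
  exact: (subspaceB sM My (subspace_sum_fin sM f0)).
have [c [u Mu [v Mv uvE]]] := f_gen My.
have [[p [Hp pE]] [q [Hq qE]]] := (IH u Mu, IH v Mv).
exists (fun i x => c i + cz x * p i x + cw x * q i x); split.
  by move=> i; apply: shift_memD.
exists (u - \sum_i smul (p i) (f i)) => //.
exists (v - \sum_i smul (q i) (f i)) => //.
have -> : y = mulz u + mulw v + \sum_i c i *: f i by rewrite uvE subrK.
apply/funext => x.
rewrite -[LHS]/(cz x *: (u - \sum_i smul (p i) (f i)) x + cw x *: (v - \sum_i smul (q i) (f i)) x).
rewrite -[RHS]/(cz x *: u x + cw x *: v x + (\sum_i c i *: f i) x - (\sum_i smul _ (f i)) x).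
rewrite -[(u - _) x]/(u x - (\sum_i smul (p i) (f i)) x).
rewrite -[(v - _) x]/(v x - (\sum_i smul (q i) (f i)) x).
rewrite !fct_sumE !scalerBr addrACA -opprD -[RHS]addrA; congr (_ + _).
rewrite -[RHS]opprB -[in RHS]sumrB !scaler_sumr -big_split /=; congr (- _).
apply: eq_bigr => i _; rewrite -[(c i *: f i) x]/(c i *: f i x) /smul.
by rewrite !scalerA -scalerBl -scalerDl; congr (_ *: _); ring.
Qed.

Context {r : nat} (rows : 'I_r -> 'I_m) (cols : 'I_r -> 'I_N).
Let A x : 'M[C]_(m, N) := \matrix_i f i x.
Let B x : 'M[C]_r := \matrix_(i, j) f (rows i) x 0 (cols j).
Let delta x := \det (B x).
Hypothesis rank_le : forall x, (\rank (A x) <= r)%N.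
Hypothesis delta_neq0 : exists x, delta x != 0.

(** Where delta is nonzero this is delta times the coefficient of f_j on the i-th selected
    generator; written with the adjugate it also makes sense at zeros of delta. *)
Let cramer j i x := \sum_l f j x 0 (cols l) * \adj (B x) l i.

Lemma minor_multiplier i j : SM (fun x => B x i j).
Proof. by under eq_fun do rewrite mxE; apply: multiplier_coord. Qed.

Lemma delta_multiplier : SM delta.
Proof. by apply: scalar_multiplier_det; apply: minor_multiplier. Qed.

Lemma cramer_multiplier j i : SM (cramer j i).
Proof.
apply: scalar_multiplier_sum => l; apply: scalar_multiplierM.
  exact: multiplier_coord.
by apply: scalar_multiplier_adj; apply: minor_multiplier.
Qed.

(** A nonzero minor of maximal size makes the selected rows span the row space at x; the selected
    columns then determine the coefficients. *)
Lemma cramer_rule_neq0 j x : delta x != 0 ->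
  delta x *: f j x = \sum_i cramer j i x *: f (rows i) x.
Proof.
move=> d0; pose A' := rowsub rows (A x).
have BE : B x = colsub cols A' by apply/matrixP => i l; rewrite !mxE.
have uB : B x \in unitmx by rewrite unitmxE unitfE.
have rA' : \rank A' = r.
  apply/eqP; rewrite eqn_leq rank_leq_row /=.
  rewrite -{1}(mxrank_unit uB) BE.
  have -> : colsub cols A' = A' *m colsub cols 1%:M by rewrite mulmx_colsub mulmx1.
  exact: mxrankM_maxl.
have sA : (A' <= A x)%MS.
  apply/row_subP => i; rewrite row_rowsub; exact: row_sub.
have AA' : (A x <= A')%MS.
  by have := mxrank_leqif_sup sA => -[_ <-]; rewrite eqn_leq mxrankS //= rA' rank_le.
have /submxP[u uE] := submx_trans (row_sub j (A x)) AA'.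
have fE : f j x = u *m A' by rewrite -uE; apply/rowP => l; rewrite !mxE.
have cE i : cramer j i x = delta x * u 0 i.
  have -> : cramer j i x = (colsub cols (f j x) *m \adj (B x)) 0 i.
    by rewrite mxE; apply: eq_bigr => l _; congr (_ * _); rewrite [RHS]mxE.
  by rewrite fE -mulmx_colsub -BE -mulmxA mul_mx_adj mul_mx_scalar mxE.
rewrite [in LHS]fE mulmx_sum_row scaler_sumr; apply: eq_bigr => i _.
rewrite cE scalerA; congr (_ *: _).
by apply/rowP => l; rewrite !mxE.
Qed.

(* At the zeros of delta, the identity follows from delta h = 0 => h = 0 in H^2. *)
Lemma cramer_rule j x : delta x *: f j x = \sum_i cramer j i x *: f (rows i) x.
Proof.
apply/rowP => l; apply/eqP; rewrite -subr_eq0; apply/eqP.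
pose h x := delta x * f j x 0 l - \sum_i cramer j i x * f (rows i) x 0 l.
have Hh : HS h.
  apply: fockB; first by apply: delta_multiplier; apply: scalar_multiplier_mem; apply: multiplier_coord.
  apply: scalar_multiplier_mem; apply: scalar_multiplier_sum => i.
  by apply: scalar_multiplierM; [apply: cramer_multiplier|apply: multiplier_coord].
have [d dP] := vanishing_valuation (scalar_multiplier_mem delta_multiplier) delta_neq0.
have hE y : h y = (delta y *: f j y - \sum_i cramer j i y *: f (rows i) y) 0 l.
  by rewrite /h !mxE summxE; congr (_ - _); apply: eq_bigr => i _; rewrite mxE.
have dh y : delta y * h y = 0.
  have [->|/(cramer_rule_neq0 j) e] := eqVneq (delta y) 0; first by rewrite mul0r.
  by rewrite hE e subrr mxE mulr0.
have h0 : h = fun=> 0.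
  apply: (identity_theorem Hh) => k; apply: dP => //.
  by have -> : (fun y => delta y * h y) = (fun=> 0) by [apply/funext]; apply: ord_ge0.
by have := congr1 (@^~ x) h0; rewrite hE mxE [(- _ : 'rV_N) 0 l]mxE.
Qed.

Variable d : nat.
Hypothesis delta_val : forall p, HS p -> forall k,
  ord_ge (d + k) (fun x => delta x * p x) -> ord_ge k p.

(* If sum_i p_i f_i vanishes to order k, multiplying by the adjugate of the minor shows
   that delta p_i does too, so p_i vanishes to order k - d. *)
Lemma lower_length k n : is_quot_dim M (M `&` vvanish k) n ->
  (r * 'C((k - d).+1, 2) <= n)%N.
Proof.
have [kd|dk] := ltnP k d.
  have /eqP -> : (k - d == 0)%N by rewrite subn_eq0 ltnW.
  by rewrite bin_small ?muln0.
set k' := (k - d)%N => dn.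
have sv := vanish_subspace H2 k'.
have [e [He es ei]] := (is_quot_dimP _ sH.1 sv).1 (quot_dim_vanish H2 k').
set D := 'C(k'.+1, 2) in e He es ei *.
have -> : (r * D = #|{: 'I_r * 'I_D}|)%N by rewrite card_prod !card_ord.
have sMv : is_subspace (M `&` vvanish k).
  split; first by split; [case: sM|case: (vvanish_subspace k)].
  move=> c g h [Mg gk] [Mh hk]; split; first exact: sM.2.
  exact: (vvanish_subspace k).2.
apply: (leq_quot_dim_indep (a := fun t : 'I_r * 'I_D => smul (e t.2) (f (rows t.1))) sM.1 sMv dn).
  by move=> t; apply: f_mult.
move=> c [_ cv] [i l]; pose p i := \sum_l c (i, l) *: e l.
have Hp i' : HS (p i').
  exact: (@subspace_sum _ _ _ _ _ xpredT (fun l => c (i', l) *: e l) sH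
    (fun l _ => subspaceZ (c (i', l)) sH (He l))).
have pB j : ord_ge k (fun x => \sum_i p i x * B x i j).
  have [_] := cv (cols j); congr ord_ge; apply/funext => x.
  rewrite coordf_lincomb fct_sumE.
  rewrite sum_pairE /=.
  apply: eq_bigr => i' _; rewrite /p fct_sumE mulr_suml; apply: eq_bigr => l' _.
  rewrite -[LHS]/(c (i', l') * (coordf (smul (e l') (f (rows i'))) (cols j)) x).
  by rewrite coordf_smul mxE mulrA.
have pd : ord_ge k (fun x => delta x * p i x).
  have : ord_ge k (fun x => \sum_j (\sum_i p i x * B x i j) * \adj (B x) j i).
    apply: ord_ge_sum => j; rewrite -[k]addn0; apply: ord_geM => //.
    apply: fock_bounded; apply: scalar_multiplier_mem.
    by apply: scalar_multiplier_adj; apply: minor_multiplier.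
  congr ord_ge; apply/funext => x.
  transitivity (((\row_i p i x) *m (B x *m \adj (B x))) 0 i).
    rewrite mulmxA mxE; apply: eq_bigr => j _; congr (_ * _).
    by rewrite mxE; apply: eq_bigr => i' _; rewrite [in RHS]mxE.
  by rewrite mul_mx_adj mul_mx_scalar !mxE.
apply: (ei (fun l => c (i, l))); split; first exact: Hp.
by apply: delta_val (Hp i) _ _; rewrite subnKC.
Qed.

(* By Cramer's rule delta p f_j lies in the H^2-span of the r selected generators, so
   each of the m generators only adds dim H^2/(I^k H^2 + delta H^2) = O(k). *)
Lemma upper_length k : exists n, is_quot_dim M (IM k) n /\
  (n <= r * 'C(k.+1, 2) + m * ('C(k.+1, 2) - 'C((k - d).+1, 2)))%N.
Proof.
have sv := vanish_subspace H2 k.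
have [e [He es _]] := (is_quot_dimP _ sH.1 sv).1 (quot_dim_vanish H2 k).
set D := 'C(k.+1, 2) in e He es *.
(* J is delta H^2 + I^k H^2, and t below is its codimension in H^2. *)
pose J : set (X -> C) := [set g | HS g /\ exists2 p, HS p & vanish H2 k (fun x => g x - delta x * p x)].
have sJ : is_subspace J.
  split.
    split; first by case: sH.
    exists (fun=> 0); first exact: fock_cst.
    by under eq_fun do rewrite mulr0 subr0; case: sv.
  move=> c g h [Hg [p Hp gp]] [Hh [q Hq hq]]; split; first exact: sH.2.
  exists (c *: p + q); first exact: sH.2.
  have := sv.2 c _ _ gp hq; congr (vanish _ _ _); apply/funext => x.
  rewrite -[LHS]/(c * (g x - delta x * p x) + (h x - delta x * q x)).
  rewrite -[RHS]/(c * g x + h x - delta x * (c * p x + q x)); ring.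
have vJ : vanish H2 k `<=` J.
  move=> g gk; split; first by case: gk.
  by exists (fun=> 0); [exact: fock_cst|under eq_fun do rewrite mulr0 subr0].
have [t [tD dt dJ]] := sub_quot_dim sH sJ sv vJ (fun g => @proj1 _ _) (quot_dim_vanish H2 k).
have tle : (t <= D - 'C((k - d).+1, 2))%N.
  rewrite -/D in tD dJ.
  (* Multiplication by delta embeds H^2 / I^(k-d) H^2 into J / I^k H^2, which bounds the dimension
     of the latter from below. *)
  suff h : ('C((k - d).+1, 2) <= D - t)%N by lia.
  have [kd|dk] := ltnP k d.
    by have /eqP -> : (k - d == 0)%N by rewrite subn_eq0 ltnW.
  have sv' := vanish_subspace H2 (k - d).
  have [e' [He' _ ei']] := (is_quot_dimP _ sH.1 sv').1 (quot_dim_vanish H2 (k - d)).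
  rewrite -[X in (X <= _)%N]card_ord.
  apply: (leq_quot_dim_indep (a := fun l => (fun x => delta x * e' l x) : X -> C) sJ.1 sv dJ).
    move=> l; have Hl := delta_multiplier (He' l); split => //.
    by exists (e' l) => //; under eq_fun do rewrite subrr; apply: sv.1.
  move=> c [_ ck]; apply: ei'; split.
    exact: (@subspace_sum _ _ _ _ _ xpredT (fun l => c l *: e' l) sH
      (fun l _ => subspaceZ (c l) sH (He' l))).
  apply: delta_val.
    exact: (@subspace_sum _ _ _ _ _ xpredT (fun l => c l *: e' l) sH
      (fun l _ => subspaceZ (c l) sH (He' l))).
  rewrite subnKC //; move: ck; congr ord_ge; apply/funext => x.
  rewrite !fct_sumE mulr_sumr; apply: eq_bigr => l _.
  by rewrite -[LHS]/(c l * (delta x * e' l x)) mulrCA.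
have [a [Ha as_ _]] := (is_quot_dimP _ sH.1 sJ).1 dt.
have sI := ideal_pow_mul_subspace k sM.
have [||n dn nle] := @span_quot_dim _ _ M (IM k) _
  (fun z : ('I_r * 'I_D) + ('I_m * 'I_t) => match z with
    | inl il => smul (e il.2) (f (rows il.1))
    | inr jl => smul (a jl.2) (f jl.1) end) sM.1 sI.
- by case=> [[i l]|[j l]] /=; apply: f_mult.
- move=> y My; have [p [Hp pE]] := generators_pow k My.
  have /choice[c cP] := fun j => as_ _ (Hp j).
  have /choice[q qP] : forall j, exists q, HS q /\
      vanish H2 k (fun x => (p j - \sum_l c j l *: a l) x - delta x * q x).
    by move=> j; have [_ [q]] := cP j; exists q.
  (* Modulo I^k H^2, p_j is a combination of the a_l plus delta q_j. Cramer's rule moves delta q_j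
     f_j to the selected generators, where g_i is the total coefficient. *)
  pose g i x := \sum_j cramer j i x * q j x.
  have Hg i : HS (g i).
    rewrite /g; elim: (index_enum _) => [|j s IH].
      by under eq_fun do rewrite big_nil; apply: fock_cst.
    under eq_fun do rewrite big_cons.
    by apply: (subspaceD sH _ IH); apply: cramer_multiplier; case: (qP j).
  have /choice[b bP] := fun i => es _ (Hg i).
  exists (fun z => match z with inl il => b il.1 il.2 | inr jl => c jl.1 jl.2 end).
  rewrite big_sumType /=.
  rewrite !sum_pairE /=.
  (* The errors v and w vanish to order k, so [smul_vanish] sends their contribution to I^k M. *)
  pose v j : X -> C := fun x => (p j - \sum_l c j l *: a l) x - delta x * q j x.
  pose w i : X -> C := g i - \sum_l b i l *: e l.
  have E : \sum_i smul (p i) (f i) = \sum_i \sum_l b i l *: smul (e l) (f (rows i)) +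
     \sum_j \sum_l c j l *: smul (a l) (f j) + \sum_j smul (v j) (f j) + \sum_i smul (w i) (f (rows i)).
    apply/funext => x.
    rewrite -[RHS]/((\sum_i \sum_l b i l *: smul (e l) (f (rows i))) x +
     (\sum_j \sum_l c j l *: smul (a l) (f j)) x + (\sum_j smul (v j) (f j)) x +
     (\sum_i smul (w i) (f (rows i))) x).
    rewrite !fct_sumE.
    have e1 i : (\sum_l b i l *: smul (e l) (f (rows i))) x = (\sum_l b i l * e l x) *: f (rows i) x.
      by rewrite fct_sumE scaler_suml; apply: eq_bigr => l _; rewrite -scalerA.
    have e2 j : (\sum_l c j l *: smul (a l) (f j)) x = (\sum_l c j l * a l x) *: f j x.
      by rewrite fct_sumE scaler_suml; apply: eq_bigr => l _; rewrite -scalerA.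
    under [X in _ = X + _ + _ + _]eq_bigr do rewrite e1.
    under [X in _ = _ + X + _ + _]eq_bigr do rewrite e2.
    have e3 j : smul (v j) (f j) x = p j x *: f j x - (\sum_l c j l * a l x) *: f j x -
        q j x *: (\sum_i cramer j i x *: f (rows i) x).
      rewrite -cramer_rule scalerA [q j x * _]mulrC -!scalerBl /smul /v.
      by rewrite -[(p j - _) x]/(p j x - (\sum_l c j l *: a l) x) fct_sumE.
    have e4 i : smul (w i) (f (rows i)) x = g i x *: f (rows i) x - (\sum_l b i l * e l x) *: f (rows i) x.
      by rewrite -scalerBl /smul /w -[(g i - _) x]/(g i x - (\sum_l b i l *: e l) x) fct_sumE.
    under [X in _ = _ + X + _]eq_bigr do rewrite e3.
    under [X in _ = _ + _ + _ + X]eq_bigr do rewrite e4.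
    rewrite !sumrB.
    have -> : \sum_j q j x *: (\sum_i cramer j i x *: f (rows i) x) = \sum_i g i x *: f (rows i) x.
      under eq_bigr do rewrite scaler_sumr.
      rewrite exchange_big /=; apply: eq_bigr => i _; rewrite scaler_suml.
      by apply: eq_bigr => j _; rewrite scalerA mulrC.
    rewrite -[LHS]/(\sum_i p i x *: f i x).
    set s1 := \sum_i (\sum_l b i l * e l x) *: _; set s2 := \sum_j (\sum_l c j l * a l x) *: _.
    set s3 := \sum_i g i x *: _; set s4 := \sum_i p i x *: _.
    by apply/rowP => l; rewrite !mxE; ring.
  have I1 : IM k (\sum_j smul (v j) (f j)).
    have h j : IM k (smul (v j) (f j)) by apply: smul_vanish => //; case: (qP j).
    exact: (subspace_sum_fin sI h).
  have I2 : IM k (\sum_i smul (w i) (f (rows i))).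
    have h i : IM k (smul (w i) (f (rows i))) by apply: smul_vanish => //; apply: bP.
    exact: (subspace_sum_fin sI h).
  have := subspaceD sI pE (subspaceD sI I1 I2).
  have cancel (z t1 t2 t3 : V) : z - (t1 + t2 + t3) + (t2 + t3) = z - t1.
    by rewrite -[t1 + _ + _]addrA opprD [z + _]addrA subrK.
  by rewrite E cancel.
exists n; split => //; apply: leq_trans nle _.
by rewrite card_sum !card_prod !card_ord leq_add2l leq_mul2l tle orbT.
Qed.

End Generators.
End InvariantSubspace.
End ModuleLengths.

(** * Multiplicities *)

(** Rows and columns are selected at one point where the rank is largest, so the same minor serves
    at all points. *)
Lemma exists_max_minor {F : fieldType} {T : Type} (t0 : T) m n (A : T -> 'M[F]_(m, n)) :
  exists r (rows : 'I_r -> 'I_m) (cols : 'I_r -> 'I_n),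
    (forall x, (\rank (A x) <= r)%N) /\
    exists x, \det (\matrix_(i, j) A x (rows i) (cols j)) != 0.
Proof.
pose P k := `[< exists x, \rank (A x) = k >].
have exP : exists k, P k by exists (\rank (A t0)); apply/asboolP; exists t0.
have leP k : P k -> (k <= m)%N by move=> /asboolP[x <-]; apply: rank_leq_row.
case: (ex_maxnP exP leP) => r /asboolP[x0 xr] rmax; subst r.
have full : row_full (rowsub (maxrankfun (A x0)) (A x0))^T.
  by rewrite /row_full mxrank_tr; have := maxrowsub_free (A x0).
exists (\rank (A x0)), (maxrankfun (A x0)), (fullrankfun full); split.
  by move=> x; apply: rmax; apply/asboolP; exists x.
exists x0; have := fullrowsub_unit full; rewrite unitmxE unitfE -det_tr.
by congr (\det _ != 0); apply/matrixP => i j; rewrite !mxE.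
Qed.

Lemma samuel_cvg {R : realType} (n : nat -> nat) (r K : R) :
  (forall k, `|2 * (n k)%:R - r * k%:R ^+ 2| <= K * k%:R) ->
  (fun k => (2`!)%:R * ((n k)%:R / k%:R ^+ 2)) @ \oo --> r.
Proof.
move=> nK; apply/cvgrPdist_lt => e e0.
exists (Num.bound (K / e)).+1 => // k /= hk.
have k0 : (0 : R) < k%:R by rewrite ltr0n (leq_trans _ hk).
have Kk : K / e < k%:R.
  have [K0|K0] := leP 0 (K / e); last exact: lt_trans K0 k0.
  by apply: lt_le_trans (archi_boundP K0) _; rewrite ler_nat ltnW.
have -> : r - (2`!)%:R * ((n k)%:R / k%:R ^+ 2) = - ((2 * (n k)%:R - r * k%:R ^+ 2) / k%:R ^+ 2).
  rewrite (_ : (2`!)%:R = 2 :> R) //; field; exact: lt0r_neq0.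
rewrite normrN normrM [`|_^-1|]ger0_norm ?invr_ge0 ?exprn_ge0 ?ltW //.
rewrite ltr_pdivrMr ?exprn_gt0 //; apply: le_lt_trans (nK k) _.
by rewrite expr2 mulrA ltr_pM2r // mulrC -ltr_pdivrMr.
Qed.

(** Truncated subtraction is harmless: for k < d, the square k^2 is below d k and is absorbed by the
    linear term. *)
Lemma triangular_bound d k :
  (2 * 'C(k.+1, 2) = k * k + k /\ k * k <= 2 * 'C((k - d).+1, 2) + 2 * d * k)%N.
Proof.
have E n : (2 * 'C(n.+1, 2) = n * n + n)%N.
  by elim: n => // n IH; rewrite binS bin1 mulnDr IH; lia.
rewrite !E; split => //; have [kd|dk] := ltnP k d.
  have : (k * k <= d * k)%N by rewrite leq_mul2r ltnW // orbT.
  lia.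
have [j ->] : exists j, k = (j + d)%N by exists (k - d)%N; rewrite subnK.
by rewrite addnK; nia.
Qed.

Section Multiplicities.
Context {R : realType} (H2 : rkhs (@fock_kernel R)) {N : nat}.
Local Notation C := R[i].
Local Notation X := (ball2 R).
Local Notation V := (X -> 'rV[C]_N).
Local Notation VF := (vfock H2 : set V).
Local Notation mz := (@mulz R N).
Local Notation mw := (@mulw R N).
Local Notation vip := (@vip R H2 N).
Local Notation sV := (@vfock_subspace R H2 N).
Local Notation hV := (@hilbert_vfock R H2 N).
Variable M : set V.
Hypothesis invM : invariant_subspace H2 M.
Local Notation sM := (inv_subspace invM).
Local Notation MV := (inv_sub invM).
Local Notation Mp := (orth H2 M).
Local Notation P := (Defs.proj H2 Mp).
Local Notation Sz := (compress H2 Mp mz).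
Local Notation Sw := (compress H2 Mp mw).

Lemma orth_sub : Mp `<=` VF.
Proof. by move=> f []. Qed.

Lemma orth_subspace : is_subspace Mp.
Proof.
split=> [|c f g [Hf fM] [Hg gM]].
  by split=> [|g Mg]; [exact: sV.1|apply: (ip0l hV); apply: MV].
split=> [|h Mh]; first exact: sV.2.
by rewrite (hil_linear hV) ?fM ?gM ?mulr0 ?addr0 //; apply: MV.
Qed.

(** M is closed, so f has a projection g onto M; f - g then satisfies the specification of [proj],
    and positivity of the norm identifies the chosen value with it. *)
Lemma proj_orth_spec f : VF f -> Mp (P f) /\ M (f - P f).
Proof.
move=> Hf; have [g Mg gP] := projection hV sM MV (inv_sq_closed invM) Hf.
have Hg := MV Mg; have Hfg := subspaceB sV Hf Hg.
have Mfg : Mp (f - g) by split.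
have ex : exists q, Mp q /\ forall h, Mp h -> vip (f - q) h = 0.
  exists (f - g); split => // h [Hh hM].
  by rewrite opprB addrC subrK (hil_conj hV Hh Hg) hM // rmorph0.
have [MP PP] := xgetPex 0 ex; rewrite -/(Defs.proj H2 Mp f) in MP PP.
split => //; have HP := orth_sub MP.
suff -> : P f = f - g by rewrite opprB addrC subrK.
apply/eqP; rewrite -subr_eq0; apply/eqP.
have Md : Mp (P f - (f - g)) by apply: (subspaceB orth_subspace).
have Hd := orth_sub Md.
apply: (hil_eq0 hV) => //.
have -> : vip (P f - (f - g)) (P f - (f - g)) =
    vip g (P f - (f - g)) - vip (f - P f) (P f - (f - g)).
  rewrite -(ipBl hV Hg (subspaceB sV Hf HP) Hd); congr (vip _ _).
  by rewrite !opprB addrCA.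
rewrite PP // subr0.
by have [_ dM] := Md; rewrite (hil_conj hV Hd Hg) dM // rmorph0.
Qed.

Lemma orth_inv0 f : Mp f -> M f -> f = 0.
Proof. by move=> [Hf fM] Mf; apply: (hil_eq0 hV) => //; apply: fM. Qed.

Lemma proj_orth_unique f q : VF f -> Mp q -> M (f - q) -> P f = q.
Proof.
move=> Hf Mq Mfq; have [MP MfP] := proj_orth_spec Hf.
apply/eqP; rewrite -subr_eq0; apply/eqP; apply: orth_inv0.
  exact: (subspaceB orth_subspace).
have := subspaceB sM Mfq MfP; congr M.
by rewrite opprB addrC addrA subrK.
Qed.

Lemma proj_orth_linear c f g : VF f -> VF g -> P (c *: f + g) = c *: P f + P g.
Proof.
move=> Hf Hg; have [[Mf MfP] [Mg MgP]] := (proj_orth_spec Hf, proj_orth_spec Hg).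
apply: proj_orth_unique; [exact: sV.2|exact: orth_subspace.2|].
have := sM.2 c _ _ MfP MgP; congr M.
by rewrite scalerBr opprD addrACA.
Qed.

Lemma proj_orthD f g : VF f -> VF g -> P (f + g) = P f + P g.
Proof. by move=> Hf Hg; rewrite -[f]scale1r proj_orth_linear // !scale1r. Qed.

Lemma proj_orth_inv f : M f -> P f = 0.
Proof.
by move=> Mf; apply: proj_orth_unique; [exact: MV|exact: orth_subspace.1|rewrite subr0].
Qed.

Lemma proj_orth_id f : Mp f -> P f = f.
Proof.
by move=> Mf; apply: proj_orth_unique; [exact: orth_sub|by []|rewrite subrr; exact: sM.1].
Qed.

(** T maps the M-part of v into M, which P kills: the compression is the action induced on H/M. *)
Lemma proj_shift (T : V -> V) v : (forall f, VF f -> VF (T f)) ->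
  (forall c f g, T (c *: f + g) = c *: T f + T g) -> (forall f, M f -> M (T f)) ->
  VF v -> P (T (P v)) = P (T v).
Proof.
move=> TV Tlin TM Hv; have [MP MvP] := proj_orth_spec Hv.
have HP := orth_sub MP; have HvP := MV MvP.
have {2}-> : v = 1 *: (v - P v) + P v by rewrite scale1r subrK.
by rewrite Tlin proj_orth_linear ?(proj_orth_inv (TM _ MvP)) ?scaler0 ?add0r //; apply: TV.
Qed.

Lemma compress_pow k : ideal_pow_mul Sz Sw k Mp = P @` (@vvanish _ H2 N k).
Proof.
have v0 : @vvanish _ H2 N 0 = VF.
  by apply/seteqP; split=> f Hf i; have := Hf i; rewrite vanish0.
have Pz v : VF v -> Sz (P v) = P (mz v).
  by apply: proj_shift; [exact: vfock_mulz|exact: mulz_linear|exact: (inv_mulz invM)].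
have Pw v : VF v -> Sw (P v) = P (mw v).
  by apply: proj_shift; [exact: vfock_mulw|exact: mulw_linear|exact: (inv_mulw invM)].
elim: k => [|k IH].
  rewrite v0; apply/seteqP; split=> [f Mf|_ [f Hf <-]].
    by exists f; [exact: orth_sub|exact: proj_orth_id].
  by case: (proj_orth_spec Hf).
rewrite /ideal_pow_mul iterS -/(ideal_pow_mul Sz Sw k Mp) IH vvanishS.
apply/seteqP; split.
  move=> _ [_ [f fk <-] [_ [g gk <-] <-]].
  have [Hf Hg] := (vvanish_sub fk, vvanish_sub gk).
  exists (mz f + mw g); first by exists f => //; exists g.
  by rewrite Pz // Pw // proj_orthD //; [apply: vfock_mulz|apply: vfock_mulw].
move=> _ [_ [f fk [g gk <-]] <-].
have [Hf Hg] := (vvanish_sub fk, vvanish_sub gk).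
exists (P f); first by exists f.
exists (P g); first by exists g.
by rewrite Pz // Pw // proj_orthD //; [apply: vfock_mulz|apply: vfock_mulw].
Qed.

Lemma compress_pow_subspace k : is_subspace (ideal_pow_mul Sz Sw k Mp).
Proof.
have [v0 vl] := @vvanish_subspace _ H2 N k.
rewrite compress_pow; split.
  by exists 0 => //; apply: proj_orth_id; exact: orth_subspace.1.
move=> c _ _ [f fk <-] [g gk <-]; exists (c *: f + g); first exact: vl.
by apply: proj_orth_linear; apply: vvanish_sub; eassumption.
Qed.

(** Two isomorphisms: P identifies H/(M + I^k H) with Q/I^k Q, and (M + I^k H)/I^k H is M/(M cap I^k
    H). The dimensions add up to that of H/I^k H. *)
Lemma orth_length k a : is_quot_dim M (M `&` @vvanish _ H2 N k) a ->
  exists n, (n + a = N * 'C(k.+1, 2))%N /\ is_quot_dim Mp (ideal_pow_mul Sz Sw k Mp) n.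
Proof.
move=> da; have sv := @vvanish_subspace _ H2 N k.
have [v0 vl] := sv.
(* B is M + I^k H, the preimage of I^k Q under P. *)
pose B : set V := [set v | VF v /\ exists2 m, M m & vvanish H2 k (v - m)].
have sB : is_subspace B.
  split.
    split; first exact: sV.1.
    by exists 0; [exact: sM.1|rewrite subr0].
  move=> c f g [Hf [m Mm fm]] [Hg [n Mn gn]]; split; first exact: sV.2.
  exists (c *: m + n); first exact: sM.2.
  by have := vl c _ _ fm gn; rewrite scalerBr opprD addrACA.
have vB : vvanish H2 k `<=` B.
  move=> v vk; split; first exact: vvanish_sub vk.
  by exists 0; [exact: sM.1|rewrite subr0].
have [n [nle dn dB]] := sub_quot_dim sV sB sv vB (fun v => @proj1 _ _) (quot_dim_vvanish H2 k).
have sMv : is_subspace (M `&` vvanish H2 k).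
  split; first by split; [exact: sM.1|].
  by move=> c g h [Mg gk] [Mh hk]; split; [exact: sM.2|exact: vl].
have dB' : is_quot_dim B (vvanish H2 k) a.
  apply: (@quot_dim_transport _ _ _ M (M `&` vvanish H2 k) B (vvanish H2 k) id a) => //.
  - exact: sM.
  - by move=> v Mv; split; [exact: MV|exists v => //; rewrite subrr].
  - by move=> c f g _ _; rewrite subrr.
  - by move=> v Mv; split=> [[]|].
  - by move=> w [Hw [m Mm wm]]; exists m.
exists n; split.
  by rewrite (is_quot_dim_uniq sB.1 sv dB' dB) subnKC.
apply: (@quot_dim_transport _ _ _ VF B Mp (ideal_pow_mul Sz Sw k Mp) P n) => //.
- exact: sV.
- exact: orth_subspace.
- exact: compress_pow_subspace.
- by move=> v /proj_orth_spec[].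
- move=> c f g Hf Hg; rewrite proj_orth_linear // subrr.
  exact: (compress_pow_subspace k).1.
- move=> v Hv; rewrite compress_pow; split.
    move=> [_ [m Mm vm]]; exists (v - m) => //.
    have HN : VF (- m) by apply: (subspaceN sV); apply: MV.
    by rewrite proj_orthD // (proj_orth_inv (subspaceN sM Mm)) addr0.
  move=> [u uk Pu]; split => //; exists (v - u); last by rewrite opprB addrC subrK.
  have [_ h1] := proj_orth_spec Hv.
  have [_ h2] := proj_orth_spec (vvanish_sub uk).
  have := subspaceB sM h1 h2; rewrite Pu; congr M.
  by rewrite opprB addrA subrK.
move=> w Mw; exists w; first exact: orth_sub.
by rewrite proj_orth_id // subrr; exact: (compress_pow_subspace k).1.
Qed.

Hypothesis finM : fin_quot_dim M (ideal_mul mz mw M).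

Lemma multiplier_generators : exists m (f : 'I_m -> V),
  (forall i, multipliers H2 M (f i)) /\ spans_mod M (ideal_mul mz mw M) f.
Proof.
have sI := ideal_mul_subspace sM.
have [m /(is_quot_dimP _ sM.1 sI)[b [Mb bs _]]] := finM.
have /choice[f fP] : forall i, exists f,
    multipliers H2 M f /\ ideal_mul mz mw M (b i - f).
  move=> i; have [g [u [v [Gg Mu Mv bE]]]] := multiplier_mod invM (Mb i).
  exists g; split => //; exists u => //; exists v => //.
  by rewrite bE [g + _]addrC addrK.
exists m, f; split=> [i|y /bs[c cI]]; first by case: (fP i).
exists c.
have h i : ideal_mul mz mw M (c i *: (b i - f i)).
  by apply: (subspaceZ _ sI); case: (fP i).
have := subspaceD sI cI (subspace_sum_fin sI h).
have -> : \sum_i c i *: (b i - f i) = \sum_i c i *: b i - \sum_i c i *: f i.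
  by rewrite -sumrB; apply: eq_bigr => i _; rewrite scalerBr.
by rewrite addrA subrK.
Qed.

Lemma lengths : exists r K : nat, forall k, exists a c,
  [/\ is_quot_dim M (M `&` @vvanish _ H2 N k) a,
      is_quot_dim M (ideal_pow_mul mz mw k M) c,
      (r * (k * k) <= 2 * a + K * k)%N, (a <= c)%N &
      (2 * c <= r * (k * k) + K * k)%N].
Proof.
have [m [f [fG fs]]] := multiplier_generators.
have [r [rows [cols [rk dx]]]] := exists_max_minor (o2 : X) (fun x => \matrix_i f i x).
have dx' : exists x, \det (\matrix_(i, j) f (rows i) x 0 (cols j)) != 0.
  have [x hx] := dx; exists x; move: hx; congr (\det _ != 0).
  by apply/matrixP => i j; rewrite !mxE.
have [d dval] := vanishing_valuation
  (scalar_multiplier_mem (delta_multiplier invM fG rows cols)) dx'.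
(* Sources of the linear error: 2dr from the loss of d orders in the lower bound, r from the linear
   term of the triangular number, m (1 + 2d) from the codimension of J for each of the m
   generators. *)
exists r, (r * (2 * d) + r + m * (1 + 2 * d))%N => k.
have [c [dc cle]] := upper_length invM fG fs rk dx' dval k.
have sI := ideal_pow_mul_subspace k sM.
have sMv : is_subspace (M `&` @vvanish _ H2 N k).
  have [v0 vl] := @vvanish_subspace _ H2 N k.
  split; first by split; [exact: sM.1|].
  by move=> c' g h [Mg gk] [Mh hk]; split; [exact: sM.2|exact: vl].
have [||a [ac da _]] := sub_quot_dim sM sMv sI _ _ dc.
- by move=> g gk; split; [exact: (ideal_pow_mul_sub invM gk)|exact: (ideal_pow_mul_vvanish invM gk)].
- by move=> g [].
have ale := lower_length invM fG dval da.
exists a, c; split => //.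
- have [_ h] := triangular_bound d k; move: ale h.
  by move: 'C(_, _) => D ale h; nia.
have [h1 h2] := triangular_bound d k.
have : (2 * ('C(k.+1, 2) - 'C((k - d).+1, 2)) <= (1 + 2 * d) * k)%N by lia.
move: cle h1; move: ('C(k.+1, 2) - _)%N => E.
by move: 'C(_, _) => D cle h1 h3; nia.
Qed.

End Multiplicities.

Theorem theorem15 (R : realType) (H2 : rkhs (@fock_kernel R)) (N : nat)
    (M : set (ball2 R -> 'rV[R[i]]_N)) :
  invariant_subspace H2 M ->
  fin_quot_dim M (ideal_mul (@mulz R N) (@mulw R N) M) ->
  let Mp := orth H2 M in
  let Sz := compress H2 Mp (@mulz R N) in
  let Sw := compress H2 Mp (@mulw R N) in
  [/\ samuel_defined R (@mulz R N) (@mulw R N) M,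
      samuel_defined R Sz Sw Mp
    & samuel_mult R (@mulz R N) (@mulw R N) M + samuel_mult R Sz Sw Mp = N%:R].
Proof.
move=> invM finM Mp Sz Sw.
have [r [K rK]] := lengths invM finM.
have sM := inv_subspace invM.
have cM : samuel_seq R (@mulz R N) (@mulw R N) M @ \oo --> (r%:R : R).
  apply: (@samuel_cvg _ _ _ K%:R) => k.
  have [a [c [_ dc ha ac hc]]] := rK k.
  rewrite (quot_dimE sM.1 (ideal_pow_mul_subspace k sM) dc).
  have h1 : (r * (k * k) <= 2 * c + K * k)%N by lia.
  move: h1 hc; rewrite -!(ler_nat R) !natrD !natrM -expr2 => h1 h2.
  by rewrite ler_norml; apply/andP; split; lra.
have cMp : samuel_seq R Sz Sw Mp @ \oo --> (N%:R - r%:R : R).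
  (* N comes from the linear term of N k (k + 1), K from the estimate for M. *)
  apply: (@samuel_cvg _ _ _ (N + K)%:R) => k.
  have [a [c [da _ ha ac hc]]] := rK k.
  have [n [na dn]] := orth_length invM da.
  rewrite (quot_dimE (orth_subspace invM).1 (compress_pow_subspace invM k) dn).
  have [h3 _] := triangular_bound 0 k.
  have {}h3 : (2 * n + 2 * a = N * (k * k) + N * k)%N by nia.
  have h2 : (2 * a <= r * (k * k) + K * k)%N by lia.
  move/(congr1 (fun j => j%:R : R)) : h3.
  move: ha h2; rewrite -!(ler_nat R) !natrD !natrM -expr2 => h1 h2 h3.
  have Nk : 0 <= N%:R * k%:R :> R by rewrite mulr_ge0.
  by rewrite ler_norml; apply/andP; split; lra.
split.
- split=> [k|]; last by apply/cvg_ex; exists r%:R.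
  by have [a [c [_ dc _ _ _]]] := rK k; exists c.
- split=> [k|]; last by apply/cvg_ex; exists (N%:R - r%:R).
  have [a [c [da _ _ _ _]]] := rK k.
  by have [n [_ dn]] := orth_length invM da; exists n.
rewrite /samuel_mult (cvg_lim (@Rhausdorff R) cM) (cvg_lim (@Rhausdorff R) cMp).
by rewrite addrC subrK.
Qed.
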